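(* Let $d\in\mathbb{N}$, let $\boldsymbol{Y}$ be a tail process over $\mathbb{Z}^d$ with index $\alpha>0$ and such that its spectral tail process $\boldsymbol{\Theta}=\boldsymbol{Y}/|Y_{\boldsymbol{0}}|$ satisfies $\mathbb{P}(\boldsymbol{\Theta}\in l_0)=1$, let $\vartheta=\mathbb{E}[|\mathrm{e}(\boldsymbol{Y})|^{-1}]$, and let $\boldsymbol{Q}=(Q_{\boldsymbol{i}})_{\boldsymbol{i}\in\mathbb{Z}^d}$ be a random element of $l_0$ such that $\|\boldsymbol{Q}\|=1$ a.s. and $\mathbb{E}\left[\sum_{\boldsymbol{k}\in\mathbb{Z}^d}|Q_{\boldsymbol{k}}|^{\alpha}\right]<\infty$. The following statements are equivalent. (i) $\boldsymbol{Q}$ is a representative of the anchored spectral tail process (of $\boldsymbol{Y}$). (ii) For all measurable $h:l_0\to[0,\infty)$, $$\mathbb{E}[h(\boldsymbol{\Theta})]=\frac{1}{\mathbb{E}\left[\sum_{\boldsymbol{k}\in\mathbb{Z}^d}|Q_{\boldsymbol{k}}|^{\alpha}\right]}\,\mathbb{E}\left[\sum_{\boldsymbol{k}\in\mathbb{Z}^d}h\left(\frac{\varphi_{\boldsymbol{k}}\boldsymbol{Q}}{|Q_{\boldsymbol{k}}|}\right)|Q_{\boldsymbol{k}}|^{\alpha}\right],$$ where the $\boldsymbol{k}$th summand is understood to be zero if $|Q_{\boldsymbol{k}}|=0$. (iii) For all measurable $h:l_0\to[0,\infty)$ which are shift-invariant, $$\mathbb{E}[h(\boldsymbol{Q})]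=\vartheta^{-1}\,\mathbb{E}\left[h\left(\frac{\boldsymbol{\Theta}}{\|\boldsymbol{\Theta}\|}\right)\cdot\frac{\|\boldsymbol{\Theta}\|^{\alpha}}{\sum_{\boldsymbol{k}\in\mathbb{Z}^d}|\Theta_{\boldsymbol{k}}|^{\alpha}}\right].$$
   Context: $\mathbb{R}^{\mathbb{Z}^d}$ carries the product $\sigma$-algebra; $|\boldsymbol{i}|=\max_k|i_k|$ for $\boldsymbol{i}\in\mathbb{Z}^d$. $l_0=\{\boldsymbol{x}\in\mathbb{R}^{\mathbb{Z}^d}:\lim_{|\boldsymbol{i}|\to\infty}|x_{\boldsymbol{i}}|=0\}$ with norm $\|\boldsymbol{x}\|=\sup_{\boldsymbol{i}}|x_{\boldsymbol{i}}|$. For $\boldsymbol{k}\in\mathbb{Z}^d$ the shift is $\varphi_{\boldsymbol{k}}\boldsymbol{x}=(x_{\boldsymbol{i}+\boldsymbol{k}})_{\boldsymbol{i}\in\mathbb{Z}^d}$. $\mathrm{e}(\boldsymbol{x})=\{\boldsymbol{k}:|x_{\boldsymbol{k}}|>1\}$, with cardinality $|\mathrm{e}(\boldsymbol{x})|$; $\mathcal{E}_0=\{\boldsymbol{x}\in\mathbb{R}^{\mathbb{Z}^d}:|x_{\boldsymbol{0}}|>1,|\mathrm{e}(\boldsymbol{x})|<\infty\}$. A function $h$ on $l_0$ is shift-invariant if $h(\varphi_{\boldsymbol{k}}\boldsymbol{x})=h(\boldsymbol{x})$ for all $\boldsymbol{x}\in l_0,\boldsymbol{k}\in\mathbb{Z}^d$.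 Tail process: $\boldsymbol{Y}=(Y_{\boldsymbol{i}})_{\boldsymbol{i}\in\mathbb{Z}^d}$ is the tail process of a (strictly) stationary real-valued random field $\boldsymbol{X}$ if $\mathbb{P}(|Y_{\boldsymbol{0}}|>1)=1$ and, for every $m\in\mathbb{N}$, the conditional distribution of $(u^{-1}X_{\boldsymbol{i}})_{\boldsymbol{i}\in\{-m,\dots,m\}^d}$ given $|X_{\boldsymbol{0}}|>u$ converges weakly, as $u\to\infty$, to the distribution of $(Y_{\boldsymbol{i}})_{\boldsymbol{i}\in\{-m,\dots,m\}^d}$. It is known that then $|Y_{\boldsymbol{0}}|$ is $\mathrm{Pareto}(\alpha)$-distributed ($\mathbb{P}(|Y_{\boldsymbol{0}}|>y)=y^{-\alpha}$, $y\ge1$) for some $\alpha>0$, called the (tail) index, and independent of the spectral tail process $\boldsymbol{\Theta}=\boldsymbol{Y}/|Y_{\boldsymbol{0}}|$. The condition $\mathbb{P}(\boldsymbol{\Theta}\in l_0)=1$ is equivalent to $\mathbb{P}(\boldsymbol{Y}\in\mathcal{E}_0)=1$. Anchoring function: a measurable map $A:\mathcal{E}_0\to\mathbb{Z}^d$ such that for all $\boldsymbol{x}\in\mathcal{E}_0$, $A(\boldsymbol{x})\in\mathrm{e}(\boldsymbol{x})$ and $A(\varphi_{\boldsymbol{k}}\boldsymbol{x})+\boldsymbol{k}=A(\boldsymbol{x})$ for all $\boldsymbol{k}\in\mathrm{e}(\boldsymbol{x})$. For such $A$, $\boldsymbol{Z}^A$ denotes a random element of $\mathcal{E}_0$ with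 distribution $\mathbb{P}(\boldsymbol{Y}\in\cdot\mid A(\boldsymbol{Y})=\boldsymbol{0})$ (the anchored process), and $\boldsymbol{Q}^A=\boldsymbol{Z}^A/\|\boldsymbol{Z}^A\|$. One has $\vartheta=\mathbb{P}(A(\boldsymbol{Y})=\boldsymbol{0})>0$ for every $A$. A random element $\boldsymbol{Q}$ of $l_0$ is a representative of the anchored spectral (tail) process of $\boldsymbol{Y}$ if $\mathbb{E}[h(\boldsymbol{Q})]=\mathbb{E}[h(\boldsymbol{Q}^A)]$ for all shift-invariant measurable $h:l_0\to[0,\infty)$, for some (equivalently, every) anchoring function $A$. *)

(* Defs.v *)
From mathcomp Require Import all_boot all_order all_algebra.
From mathcomp Require Import finmap.
From mathcomp Require Import all_classical all_reals all_analysis.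

Set Implicit Arguments.
Unset Strict Implicit.
Unset Printing Implicit Defensive.

Import Order.TTheory GRing.Theory Num.Theory.
Import numFieldNormedType.Exports.

Local Open Scope classical_set_scope.
Local Open Scope ring_scope.

Notation site d := 'rV[int]_d.

Definition site_norm (d : nat) (i : site d) : nat :=
  (\max_(k < d) `|i ord0 k|)%N.

Section Configurations.
Variables (R : realType) (d : nat).

Definition cylinders : set (set (site d -> R)) :=
  [set C | exists i : site d, exists2 B : set R, measurable B &
           C = (fun x : site d -> R => x i) @^-1` B].

(* R^(Z^d) with the product sigma-algebra *)
Definition config := g_sigma_algebraType cylinders.

Implicit Types (x : config) (i k : site d) (c : R).

Definition site_shift k x : config := fun i => x (i + k).

Definition rescale c x : config := fun i => x i / c.

(* [sup] is 0 on unbounded sets; the norm is only meaningful for bounded x,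
   in particular for x in [l0] or in [E0]. *)
Definition supnorm x : R := sup (range (fun i => `|x i|)).

Definition l0 : set config :=
  [set x | forall eps : R, 0 < eps ->
     exists n : nat, forall i, (n <= site_norm i)%N -> `|x i| < eps].

Definition exceed x : set (site d) := [set k | 1 < `|x k|].

Definition E0 : set config :=
  [set x | 1 < `|x 0| /\ finite_set (exceed x)].

(* 1 / |e(x)|. If e(x) is infinite then [fset_set] is empty and the value is
   0 = 1 / oo; it is also 0 if e(x) is empty, which for a tail process has
   probability 0. *)
Definition inv_card_exceed x : R := (#|` fset_set (exceed x)|)%fset%:R^-1.

(* Measurability of A : E0 -> Z^d is with respect to the discrete
   sigma-algebra on Z^d; the values of A outside E0 play no role. *)
Definition anchoring (A : config -> site d) : Prop :=
  [/\ forall B : set (site d), measurable (E0 `&` A @^-1` B),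
      forall x, E0 x -> exceed x (A x) &
      forall x, E0 x -> forall k, exceed x k -> A (site_shift k x) + k = A x].

(* A measurable function l0 -> [0, oo), given by a total function whose values
   outside l0 are irrelevant. *)
Definition l0_nneg_measurable (h : config -> R) : Prop :=
  measurable_fun l0 h /\ forall x, l0 x -> 0 <= h x.

Definition shift_invariant (h : config -> R) : Prop :=
  forall x, l0 x -> forall k, h (site_shift k x) = h x.

Definition window (m : nat) := {i : site d | (site_norm i <= m)%N}.

Definition restrict_window (m : nat) x : {ptws window m -> R} :=
  fun j => x (sval j).

Definition sum_power (alpha : R) x : \bar R :=
  (\esum_(k in [set: site d]) (`|x k| `^ alpha)%:E)%E.

End Configurations.

Section RandomFields.
Variables (R : realType) (d : nat).

Section OneField.
Context {disp : measure_display} {T : measurableType disp}.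
Variable P : probability T R.

Definition stationary (X : {RV P >-> config R d}) : Prop :=
  forall (k : site d) (B : set (config R d)), measurable B ->
    P [set w | B (site_shift k (X w))] = P [set w | B (X w)].

(* E[f(V)] for a measurable V with P(V in l0) = 1 and a function f on l0
   (values of f outside l0 are not used) *)
Definition expect_l0 (V : T -> config R d) (f : config R d -> \bar R) : \bar R :=
  (\int[P]_(w in V @^-1` @l0 R d) f (V w))%E.

Definition spectral (Y : {RV P >-> config R d}) (w : T) : config R d :=
  rescale `|Y w 0| (Y w).

Definition vartheta (Y : {RV P >-> config R d}) : \bar R :=
  'E_P[fun w => inv_card_exceed (Y w)]%E.

Definition tail_index (Y : {RV P >-> config R d}) (alpha : R) : Prop :=
  forall y : R, 1 <= y -> P [set w | y < `|Y w 0|] = (y `^ (- alpha))%:E.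

End OneField.

(* Weak convergence of the conditional laws on R^({-m..m}^d), tested against
   bounded functions that are continuous for the product topology. The
   positivity of P(|X_0| > u) is what makes the conditional laws exist. *)
Definition tail_process_of
    (dispX : measure_display) (TX : measurableType dispX)
    (PX : probability TX R) (X : {RV PX >-> config R d})
    (dispY : measure_display) (TY : measurableType dispY)
    (PY : probability TY R) (Y : {RV PY >-> config R d}) : Prop :=
  [/\ PY [set w | 1 < `|Y w 0|] = 1%E,
      forall u : R, 0 < u -> (0 < PX [set w | (u < `|X w 0%R|)%R])%E &
      forall (m : nat) (f : {ptws window d m -> R} -> R),
        continuous f -> (exists M : R, forall z, `|f z| <= M) ->
        ((\int[PX]_(w in [set w | (u < `|X w 0%R|)%R])
            (f (restrict_window (rescale u (X w))))%:E)
          / PX [set w | (u < `|X w 0%R|)%R])%E @[u --> +oo%R]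
        --> (\int[PY]_w (f (restrict_window (Y w)))%:E)%E].

Definition tail_process
    (disp : measure_display) (T : measurableType disp)
    (P : probability T R) (Y : {RV P >-> config R d}) : Prop :=
  exists (dispX : measure_display) (TX : measurableType dispX)
         (PX : probability TX R) (X : {RV PX >-> config R d}),
    stationary X /\ tail_process_of X Y.

(* Z is a random element of E0 with law P(Y in . | A(Y) = 0) *)
Definition anchored_process
    (disp : measure_display) (T : measurableType disp)
    (P : probability T R) (Y : {RV P >-> config R d})
    (A : config R d -> site d)
    (dispZ : measure_display) (TZ : measurableType dispZ)
    (PZ : probability TZ R) (Z : {RV PZ >-> config R d}) : Prop :=
  (forall w, E0 (Z w)) /\
  forall B : set (config R d), measurable B ->
    PZ [set w | B (Z w)] =
      (P [set w | [/\ B (Y w), E0 (Y w) & A (Y w) = 0%R]]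
        / P [set w | E0 (Y w) /\ A (Y w) = 0%R])%E.

Definition anchored_spectral_representative
    (disp : measure_display) (T : measurableType disp)
    (P : probability T R) (Y : {RV P >-> config R d})
    (dispQ : measure_display) (TQ : measurableType dispQ)
    (PQ : probability TQ R) (Q : {RV PQ >-> config R d}) : Prop :=
  exists A : config R d -> site d, anchoring A /\
  exists (dispZ : measure_display) (TZ : measurableType dispZ)
         (PZ : probability TZ R) (Z : {RV PZ >-> config R d}),
    anchored_process Y A Z /\
    forall h : config R d -> R, l0_nneg_measurable h -> shift_invariant h ->
      expect_l0 PQ Q (fun x => (h x)%:E) =
      expect_l0 PZ (fun w => rescale (supnorm (Z w)) (Z w)) (fun x => (h x)%:E).

End RandomFields.

(* Main.v *)
Require Import Defs.
From mathcomp Require Import all_boot all_order all_algebra.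
From mathcomp Require Import finmap.
From mathcomp Require Import all_classical all_reals all_analysis.
From mathcomp Require Import measurable_realfun.
From mathcomp Require Import zify.
Set Implicit Arguments.
Unset Strict Implicit.
Unset Printing Implicit Defensive.
Import Order.TTheory GRing.Theory Num.Theory.
Import numFieldNormedType.Exports.
Local Open Scope classical_set_scope.
Local Open Scope ring_scope.

(** Write Theta for the spectral tail process, |x| for the supremum norm,
    recenter k x = shift_k x / |x_k|, and D ([max_at_origin]) for the set of
    configurations whose modulus is maximal at the origin and at no
    lexicographically smaller site.
    Every configuration of l0 other than 0 has exactly one shift in D.

    Two facts about the tail process Y are extracted from the weak convergence
    that defines it: a set of configurations with exceedances at 0 and at k has
    the same probability for Y and for the shift of Y by -k
    ([exceedance_shift_law], from stationarity), and the radius |Y_0| is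
    independent of Theta ([spectral_radius_independent], by changing the
    threshold). Weak convergence is tested on continuous bumps that increase to
    the indicators of open cylinders, which avoids the discussion of continuity
    sets. For functions of the direction, with the Pareto radius integrated out,
    the first fact becomes the time change formula ([time_change]):
      E[H(recenter k Theta) |Theta_k|^alpha] = E[H(Theta); Theta_{-k} <> 0].

    Splitting according to the site where Theta has its first maximum and using
    the time change formula for each site, one obtains ([spectral_decomposition])
      E[H(Theta)] = E[sum_k H(recenter k Theta) |Theta_k|^alpha; Theta in D].
    On the other hand, moving the anchor through the exceedances of Y shows
    that E[F(Y); A(Y) = 0] = E[F(Y) / |e(Y)|] for shift-invariant F, whatever
    the anchor A ([anchor_invariance]). Taking for A the first maximum, which Y
    and Theta share, one finds that every anchored spectral process has the mean
    vartheta^-1 E[h(Theta); Theta in D] for shift-invariant h.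

    The three statements are compared with the formula ([max_formula])
      E[h(Q)] = vartheta^-1 E[h(Theta); Theta in D] for shift-invariant h.
    For (i) this is the previous remark. For (iii), the ratio
    h(x/|x|) |x|^alpha / sum_k |x_k|^alpha is invariant under shifts and
    scalings, so the decomposition takes it out of the sum, which cancels the
    denominator. The formula gives (ii) when it is applied to the shift-invariant
    function x |-> sum_k h(recenter k x) |x_k|^alpha, whose mean on D is
    E[h(Theta)] by the decomposition; conversely (ii), applied to the ratio
    above, gives the formula up to a constant, which h = 1 determines. *)

(** * Sums over countable index sets *)

Section countable_sums.
Context {R : realType} {I : countType}.
Local Open Scope ereal_scope.

Definition enum_term (a : I -> \bar R) (n : nat) : \bar R :=
  if pickle_inv n is Some i then a i else 0.

Lemma enum_term_ge0 (a : I -> \bar R) n : (forall i, 0 <= a i) ->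
  0 <= enum_term a n.
Proof. by move=> a0; rewrite /enum_term; case: pickle_inv. Qed.

(** Sums over Z^d are turned into series along an enumeration, where monotone
    convergence is available. *)
Lemma esum_nneseries (a : I -> \bar R) : (forall i, 0 <= a i) ->
  \esum_(i in [set: I]) a i = \sum_(n <oo) enum_term a n.
Proof.
move=> a0; rewrite nneseries_esumT; last by move=> n; exact: enum_term_ge0.
rewrite (esumID (range (@choice.pickle I)))//; last by move=> n _; exact: enum_term_ge0.
rewrite !setTI [X in _ + X]esum1 ?adde0; last first.
  move=> n /= nr; rewrite /enum_term; have := @pickle_invK I n.
  by case: pickle_inv => //= i ni; exfalso; apply: nr; exists i.
rewrite (reindex_esum [set: I] (range (@choice.pickle I)) (@choice.pickle I)).
  by apply: eq_esum => i _; rewrite /enum_term pickleK_inv.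
split; [by move=> i _; exists i| |by []].
by move=> i j _ _; exact: (pcan_inj (@choice.pickleK I)).
Qed.

Lemma measurable_fun_esum d (T : measurableType d) (f : I -> T -> \bar R) :
  (forall i, measurable_fun [set: T] (f i)) -> (forall i t, 0 <= f i t) ->
  measurable_fun [set: T] (fun t => \esum_(i in [set: I]) f i t).
Proof.
move=> mf f0.
under eq_fun do rewrite (esum_nneseries (fun i => f0 i _)).
apply: ge0_emeasurable_sum => [n t _ _|n _].
  by apply: (enum_term_ge0 (a := fun i => f i t)).
by rewrite /enum_term; case: (pickle_inv n) => [i|]; [exact: mf|exact: measurable_cst].
Qed.

Lemma integral_esum d (T : measurableType d) (mu : {measure set T -> \bar R})
    (f : I -> T -> \bar R) :
  (forall i, measurable_fun [set: T] (f i)) -> (forall i t, 0 <= f i t) ->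
  \int[mu]_t (\esum_(i in [set: I]) f i t) =
  \esum_(i in [set: I]) \int[mu]_t f i t.
Proof.
move=> mf f0.
under eq_integral do rewrite (esum_nneseries (fun i => f0 i _)).
rewrite esum_nneseries; last by move=> i; apply: integral_ge0 => t _.
rewrite integral_nneseries//.
- apply: eq_eseriesr => n _; rewrite /enum_term.
  by case: pickle_inv => // ; rewrite integral0.
- move=> n; rewrite /enum_term.
  by case: (pickle_inv n) => [i|]; [exact: mf|exact: measurable_cst].
- by move=> n t _; apply: (enum_term_ge0 (a := fun i => f i t)).
Qed.

(** The factor may be +oo: the series is an integral for the counting measure,
    and such integrals are homogeneous for extended factors. *)
Lemma ge0_esumZl (a : I -> \bar R) (c : \bar R) : 0 <= c -> (forall i, 0 <= a i) ->
  \esum_(i in [set: I]) (c * a i) = c * \esum_(i in [set: I]) a i.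
Proof.
move=> c0 a0; rewrite !esum_nneseries//; last by move=> i; exact: mule_ge0.
have et0 n : 0 <= enum_term a n by exact: enum_term_ge0.
rewrite -(ge0_integral_count et0) -ge0_integralZl//.
rewrite -ge0_integral_count; last by move=> n; apply: enum_term_ge0 => i; exact: mule_ge0.
by apply: eq_integral => n _; rewrite /enum_term; case: pickle_inv => //; rewrite mule0.
Qed.

Lemma esum_delta (a : I -> \bar R) (j : I) : (forall i, 0 <= a i) ->
  (forall i, i != j -> a i = 0) -> \esum_(i in [set: I]) a i = a j.
Proof.
move=> a0 aj.
rewrite (esumID [set j])//.
rewrite setTI esum_set1// setTI esum1 ?adde0// => i /= /eqP ij; exact: aj.
Qed.

Lemma measurable_forall d (T : measurableType d) (F : I -> set T) :
  (forall i, measurable (F i)) -> measurable [set x | forall i, F i x].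
Proof.
move=> mF; rewrite [X in measurable X](_ : _ = ~` (\bigcup_i (~` F i))).
  by apply: measurableC; apply: countable_bigcupT_measurable => // i;
    exact: measurableC.
apply/seteqP; split => [x Fx [i _]|x /= nF i]; first exact.
by apply: contrapT => nFi; apply: nF; exists i.
Qed.

Lemma measurable_exists d (T : measurableType d) (F : I -> set T) :
  (forall i, measurable (F i)) -> measurable [set x | exists i, F i x].
Proof.
move=> mF; rewrite [X in measurable X](_ : _ = \bigcup_i F i).
  exact: countable_bigcupT_measurable.
by apply/seteqP; split => [x [i Fi]|x [i _ Fi]]; exists i.
Qed.

End countable_sums.

(** * Almost sure events and limits *)

Lemma ereal_lim_near_unique {R : realType} {U : Type} (F : set_system U)
    {PF : ProperFilter F} (f g : U -> \bar R) (a b : \bar R) :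
  f u @[u --> F] --> a -> g u @[u --> F] --> b ->
  (\forall u \near F, f u = g u) -> a = b.
Proof.
move=> fa gb fg; apply: (cvg_unique (@ereal_hausdorff R) fa).
by apply: cvg_trans gb; apply: near_eq_cvg; near=> u; apply/esym; near: u.
Unshelve. all: by end_near. Qed.

(** Truncation: test functions with values in [0, +oo] are increasing limits of
    real-valued ones. *)
Lemma limn_mine {R : realType} (y : \bar R) : (0 <= y)%E ->
  limn (fun n => mine y n%:R%:E) = y.
Proof.
move=> y0; apply/cvg_lim => //; case: y y0 => [r r0| _|//].
  apply: cvg_near_cst; near=> n; rewrite min_l// lee_fin.
  by near: n; exact: nbhs_infty_ger.
rewrite (_ : (fun n => _) = (fun n => n%:R%:E)); first exact/cvgenyP.
by apply/funext => n; rewrite min_r// leey.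
Unshelve. all: by end_near. Qed.

Lemma probability_setI1 {d} {T : measurableType d} {R : realType} (P : probability T R)
    (A N : set T) : measurable A -> measurable N -> P N = 1%E -> P (A `&` N) = P A.
Proof.
move=> mA mN N1; apply/eqP; rewrite eq_le le_measure ?inE//=; last exact: measurableI.
rewrite -{1}(setUIDK A N) (le_trans (measureU2 _ _ _))//; [exact: measurableI|exact: measurableD|].
rewrite [X in (_ + X)%E](_ : _ = 0%E) ?adde0//.
apply/eqP; rewrite -measure_le0; apply: (@le_trans _ _ (P (~` N))).
  by apply: le_measure; rewrite ?inE; [exact: measurableD|exact: measurableC|move=> x []].
by rewrite probability_setC// N1 subee.
Qed.

(** Almost sure identities are used through a measurable event [N] of
    probability one on which they hold. *)
Lemma eq_integral_full {d} {T : measurableType d} {R : realType} (P : probability T R)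
    (N : set T) (f g : T -> \bar R) : measurable N -> P N = 1%E ->
  measurable_fun [set: T] f -> measurable_fun [set: T] g ->
  (forall w, 0 <= f w)%E -> (forall w, 0 <= g w)%E ->
  (forall w, N w -> f w = g w) -> (\int[P]_w f w = \int[P]_w g w)%E.
Proof.
move=> mN N1 mf mg f0 g0 fg; apply: ge0_ae_eq_integral => //.
have N0 : P (~` N) = 0%E by rewrite probability_setC// N1 subee.
exists (~` N); split; [exact: measurableC|exact: N0|].
by move=> w /= h Nw; apply: h => _; exact: fg.
Qed.

Section full_events.
Context {disp : measure_display} {T : measurableType disp} {R : realType}.
Variable P : probability T R.

Lemma full_of_ae (Q : T -> Prop) : {ae P, forall w, Q w} ->
  exists N, [/\ measurable N, P N = 1%E & forall w, N w -> Q w].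
Proof.
move=> [B [mB B0 QB]]; exists (~` B); split; first exact: measurableC.
  have h := probability_setC P mB.
  by rewrite h [X in (_ - X)%E]B0 sube0.
by move=> w NB; apply: contrapT => nQ; apply: NB; exact: QB.
Qed.

Lemma full_lty (f : T -> \bar R) : measurable_fun [set: T] f ->
  (forall w, 0 <= f w)%E -> (\int[P]_w f w < +oo)%E ->
  exists N, [/\ measurable N, P N = 1%E & forall w, N w -> (f w < +oo)%E].
Proof.
move=> mf f0 foo; apply: full_of_ae.
have fi : P.-integrable [set: T] f.
  by apply/integrableP; split => //; under eq_integral do rewrite gee0_abs//.
have := integrable_ae measurableT fi.
by apply: filterS => w /(_ I) h; rewrite ltey_eq h.
Qed.

Lemma integral_EFin_indic (A : set T) : measurable A ->
  (\int[P]_w (\1_A w)%:E = P A)%E.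
Proof. by move=> mA; rewrite integral_indic// setIT. Qed.

End full_events.

(** * Measurability and symmetries of configurations *)

Section events.
Context {d : measure_display} {T : measurableType d} {R : realType}.

Lemma measurable_lt_set (f g : T -> R) :
  measurable_fun [set: T] f -> measurable_fun [set: T] g ->
  measurable [set t | f t < g t].
Proof.
move=> mf mg.
have /(_ measurableT [set true]) := measurable_fun_ltr mf mg.
by rewrite setTI; apply.
Qed.

Lemma measurable_le_set (f g : T -> R) :
  measurable_fun [set: T] f -> measurable_fun [set: T] g ->
  measurable [set t | f t <= g t].
Proof.
move=> mf mg.
have /(_ measurableT [set true]) := measurable_fun_ler mf mg.
by rewrite setTI; apply.
Qed.

Lemma measurable_preimage_setT {d'} {T' : measurableType d'} (f : T -> T') (B : set T') :
  measurable_fun [set: T] f -> measurable B -> measurable (f @^-1` B).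
Proof. by move=> mf mB; rewrite -[X in measurable X]setTI; exact: mf. Qed.

Lemma measurable_fun_norm (f : T -> R) :
  measurable_fun [set: T] f -> measurable_fun [set: T] (fun t => `|f t|).
Proof. by move=> mf; apply: measurableT_comp. Qed.

(** Inversion of nonnegative reals is the power of exponent -1, which is
    measurable, also at 0 where both are 0. *)
Lemma measurable_fun_inv_ge0 (f : T -> R) : (forall t, 0 <= f t) ->
  measurable_fun [set: T] f -> measurable_fun [set: T] (fun t => (f t)^-1).
Proof.
move=> f0 mf.
rewrite (_ : (fun t => _) = (fun t => f t `^ (- 1))); last first.
  by apply/funext => t; rewrite powR_inv1.
exact: (measurableT_comp (measurable_powR (-1))).
Qed.

Lemma measurable_EFin_indic (A : set T) : measurable A ->
  measurable_fun [set: T] (fun t => (\1_A t : R)%:E).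
Proof. by move=> mA; apply/measurable_EFinP; exact: measurable_indic. Qed.

End events.

Section configurations.
Context {R : realType} {d : nat}.
Notation config := (config R d).
Implicit Types (x : config) (i k : site d).

Lemma measurable_coord i : measurable_fun [set: config] (fun x : config => x i).
Proof.
move=> _ B mB; rewrite setTI; apply: sub_sigma_algebra.
by exists i; exists B.
Qed.

Lemma measurable_norm_coord i : measurable_fun [set: config] (fun x : config => `|x i|).
Proof. by apply: measurable_fun_norm; exact: measurable_coord. Qed.

Lemma measurable_to_config d' (T : measurableType d') (f : T -> config) :
  (forall i, measurable_fun [set: T] (fun t => f t i)) -> measurable_fun [set: T] f.
Proof.
move=> mf.
have H : @measurable _ config = <<s @cylinders R d >> by [].
refine (@measurability _ _ T config setT f (@cylinders R d) H _).
by move=> _ [_ [i [B mB ->]] <-]; exact: mf.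
Qed.

Lemma measurable_shift k : measurable_fun [set: config] (@site_shift R d k).
Proof. by apply: measurable_to_config => i; exact: measurable_coord. Qed.

Lemma measurable_rescale d' (T : measurableType d') (c : T -> R) (f : T -> config) :
  (forall t, 0 <= c t) ->
  measurable_fun [set: T] c -> measurable_fun [set: T] f ->
  measurable_fun [set: T] (fun t => rescale (c t) (f t)).
Proof.
move=> c0 mc mf; apply: measurable_to_config => i.
apply: measurable_funM; last exact: measurable_fun_inv_ge0.
exact: (measurableT_comp (measurable_coord i)).
Qed.

Lemma measurable_rescale_cst c : 0 <= c -> measurable_fun [set: config] (@rescale R d c).
Proof.
move=> c0; exact: (@measurable_rescale _ config (fun=> c) id (fun=> c0)).
Qed.

(** A site of norm below [n] is coded by its coordinates shifted by [n], which
    lie in a finite set of naturals. *)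
Lemma finite_site_ball n : finite_set [set i : site d | (site_norm i < n)%N].
Proof.
pose N := (n.*2).
pose g (s : {ffun 'I_d -> 'I_N.+1}) : site d := \row_k ((s k)%:Z - n%:Z).
apply: (@sub_finite_set _ _ (range g)); last first.
  exact/finite_image/finite_finset.
move=> i /= iN.
have ik (k : 'I_d) : (absz (i ord0 k) < n)%N.
  apply: leq_ltn_trans iN; rewrite /site_norm.
  exact: (@leq_bigmax _ (fun k : 'I_d => absz (i ord0 k))).
exists [ffun k : 'I_d => inord (absz (i ord0 k + n%:Z)%R)] => //.
apply/rowP => k; rewrite !mxE ffunE inordK.
  have -> : i 0 k = i ord0 k by congr (i _ _); exact/val_inj.
  by have := ik k; lia.
by have := ik k; rewrite /N; lia.
Qed.

Lemma measurable_l0 : measurable (@l0 R d).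
Proof.
rewrite [X in measurable X](_ : _ = [set x : config | forall p : nat,
    exists n : nat, forall i : site d,
      (n <= site_norm i)%N -> `|x i| < p.+1%:R^-1]).
  apply: measurable_forall => p; apply: measurable_exists => n.
  apply: measurable_forall => i.
  case: (n <= site_norm i)%N; last first.
    by rewrite [X in measurable X](_ : _ = setT)//; apply/seteqP; split.
  rewrite [X in measurable X](_ : _ = [set x : config | `|x i| < p.+1%:R^-1]).
    apply: measurable_lt_set; [exact: measurable_norm_coord|exact: measurable_cst].
  by apply/seteqP; split => x /=; [exact|].
apply/seteqP; split => x.
  move=> xl p; have [n nx] := xl p.+1%:R^-1 ltac:(by rewrite invr_gt0).
  by exists n.
move=> xl e e0; have [n nx] := xl (Num.truncn e^-1).
exists n => i /nx /lt_le_trans; apply.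
rewrite invf_ple ?posrE//; exact/ltW/truncnS_gt.
Qed.

(** Balls of Z^d are finite, so a finite set of sites is a bounded one; in
    this form the event is a countable combination of coordinate events. *)
Lemma finite_exceedP x : finite_set (exceed x) <->
  exists n : nat, forall i, (n <= site_norm i)%N -> `|x i| <= 1.
Proof.
split.
  move=> /finite_seqP[A Ax].
  exists (\max_(i <- A) site_norm i).+1 => i ni; rewrite leNgt; apply/negP => xi.
  have : [set` A] i by rewrite -Ax.
  move=> /= iA; move: ni; rewrite ltnNge => /negP; apply.
  by rewrite (big_rem i)//= leq_maxl.
move=> [n nx]; apply: sub_finite_set (finite_site_ball n) => i /= xi.
by rewrite ltnNge; apply/negP => /nx; rewrite leNgt xi.
Qed.

Lemma measurable_finite_exceed : measurable [set x : config | finite_set (exceed x)].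
Proof.
rewrite [X in measurable X](_ : _ = [set x : config |
    exists n : nat, forall i : site d,
      (n <= site_norm i)%N -> `|x i| <= 1]).
  apply: measurable_exists => n; apply: measurable_forall => i.
  case: (n <= site_norm i)%N; last first.
    by rewrite [X in measurable X](_ : _ = setT)//; apply/seteqP; split.
  rewrite [X in measurable X](_ : _ = [set x : config | `|x i| <= 1]).
    apply: measurable_le_set; [exact: measurable_norm_coord|exact: measurable_cst].
  by apply/seteqP; split => x /=; [exact|].
apply/seteqP; split => x /=.
  by move=> /finite_exceedP[n nx]; exists n.
by move=> [n nx]; apply/finite_exceedP; exists n.
Qed.

Lemma measurable_exceed k : measurable [set x : config | exceed x k].
Proof. by apply: measurable_lt_set; [exact: measurable_cst|exact: measurable_norm_coord]. Qed.

Lemma measurable_E0 : measurable (@E0 R d).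
Proof.
rewrite [X in measurable X](_ : _ = [set x : config | exceed x 0] `&`
   [set x : config | finite_set (exceed x)])//.
by apply: measurableI; [exact: measurable_exceed|exact: measurable_finite_exceed].
Qed.

Lemma measurable_norm_coord_powR alpha k :
  measurable_fun [set: config] (fun x : config => (`|x k| `^ alpha)%:E).
Proof.
apply/measurable_EFinP.
exact: (measurableT_comp (measurable_powR alpha)) (measurable_norm_coord k).
Qed.

Lemma measurable_sum_power alpha : measurable_fun [set: config] (@sum_power R d alpha).
Proof.
apply: measurable_fun_esum => [k|k x]; last by rewrite lee_fin powR_ge0.
exact: measurable_norm_coord_powR.
Qed.

Lemma sum_power_ge0 alpha x : (0 <= sum_power alpha x)%E.
Proof. by apply: esum_ge0 => k _; rewrite lee_fin powR_ge0. Qed.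

Lemma shiftE k x i : site_shift k x i = x (i + k). Proof. by []. Qed.

Lemma shift_shift j k x : site_shift j (site_shift k x) = site_shift (j + k) x.
Proof. by apply/funext => i; rewrite !shiftE addrA. Qed.

Lemma shift0 x : site_shift 0 x = x.
Proof. by apply/funext => i; rewrite shiftE addr0. Qed.

Lemma shift_rescale k c x : site_shift k (rescale c x) = rescale c (site_shift k x).
Proof. by []. Qed.

Lemma rescale_rescale a b x : rescale a (rescale b x) = rescale (b * a) x.
Proof. by apply/funext => i; rewrite /rescale invfM mulrA. Qed.

Lemma rescale1 x : rescale 1 x = x.
Proof. by apply/funext => i; rewrite /rescale divr1. Qed.

Lemma esum_shift k (a : site d -> \bar R) :
  (\esum_(i in [set: site d]) a (i + k)%R = \esum_(i in [set: site d]) a i)%E.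
Proof.
rewrite -(@reindex_esum _ _ _ setT setT (fun i => i + k) a)//; split => //.
  by move=> i j _ _; exact: addIr.
by move=> i _; exists (i - k) => //; rewrite subrK.
Qed.

Lemma sum_power_shift alpha k x : sum_power alpha (site_shift k x) = sum_power alpha x.
Proof. exact: (esum_shift k (fun i => (`|x i| `^ alpha)%:E)). Qed.

Lemma sum_power_rescale alpha c x : 0 < c ->
  sum_power alpha (rescale c x) = ((c `^ (- alpha))%:E * sum_power alpha x)%E.
Proof.
move=> c0; rewrite /sum_power -ge0_esumZl//; last by rewrite lee_fin powR_ge0.
apply: eq_esum => i _; rewrite -EFinM; congr EFin.
rewrite normrM normfV (gtr0_norm c0) powRM ?invr_ge0 ?(ltW c0)// mulrC.
by rewrite -powR_inv1 ?(ltW c0)// -powRrM mulN1r.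
Qed.

Lemma sum_power_ge alpha k x : ((`|x k| `^ alpha)%:E <= sum_power alpha x)%E.
Proof.
apply: esum_ge.
exists [set k]; first by split => //; exact: finite_set1.
by rewrite fsbig_set1.
Qed.

Lemma l0_shift k x : l0 x -> l0 (site_shift k x).
Proof.
move=> xl e e0; have [n nx] := xl e e0.
exists (n + site_norm k)%N => i ni; apply: nx.
have : (site_norm i <= site_norm (i + k) + site_norm k)%N.
  rewrite /site_norm; apply/bigmax_leqP => j _.
  have h (a : site d) : (absz (a ord0 j) <= \max_(k < d) absz (a ord0 k))%N.
    exact: (@leq_bigmax _ (fun k : 'I_d => absz (a ord0 k))).
  have := h (i + k); have := h k.
  have -> : (i + k) ord0 j = i ord0 j + k ord0 j by rewrite mxE.
  lia.
move: ni; lia.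
Qed.

Lemma l0_shiftE k x : l0 (site_shift k x) = l0 x.
Proof.
apply/propext; split; last exact: l0_shift.
by move=> /(@l0_shift (- k)); rewrite shift_shift addNr shift0.
Qed.

Lemma l0_rescale c x : l0 x -> l0 (rescale c x).
Proof.
have [->|c0] := eqVneq c 0.
  by move=> _ e e0; exists 0%N => i _; rewrite /rescale invr0 mulr0 normr0.
move=> xl e e0; have [|n nx] := xl (e * `|c|); first by rewrite mulr_gt0 ?normr_gt0.
by exists n => i /nx; rewrite /rescale normrM normfV ltr_pdivrMr ?normr_gt0.
Qed.

Lemma l0_finite_exceed x : l0 x -> finite_set (exceed x).
Proof.
move=> xl; apply/finite_exceedP; have [n nx] := xl 1 ltr01.
by exists n => i /nx /ltW.
Qed.

Definition direction (x : config) : config := rescale `|x 0| x.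

Lemma measurable_direction : measurable_fun [set: config] direction.
Proof. by apply: measurable_rescale => //; exact: measurable_norm_coord. Qed.

Definition recenter k (x : config) : config := direction (site_shift k x).

Lemma recenterE k x : recenter k x = rescale `|x k| (site_shift k x).
Proof. by rewrite /recenter /direction shiftE add0r. Qed.

Lemma measurable_recenter k : measurable_fun [set: config] (recenter k).
Proof. exact: (measurableT_comp measurable_direction (measurable_shift k)). Qed.

Lemma direction_rescale (c : R) (x : config) : 0 < c -> direction (rescale c x) = direction x.
Proof.
move=> c0; apply/funext => i.
rewrite /direction /rescale normrM normfV (gtr0_norm c0) invfM invrK.
by rewrite mulrACA mulVf ?gt_eqF// mulr1.
Qed.

Lemma recenter_rescale (c : R) k (x : config) : 0 < c -> recenter k (rescale c x) = recenter k x.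
Proof. by move=> c0; rewrite /recenter shift_rescale direction_rescale. Qed.

End configurations.

(** * The lexicographically first maximum *)

Section lexicographic.
Context {d : nat}.
Implicit Types i j k : site d.

(** The positive cone of the lexicographic order of Z^d, which is total and
    invariant under translations; these two properties are what an anchoring
    function needs to break ties. *)
Definition lex_pos k : Prop :=
  exists2 a : 'I_d, 0 < k ord0 a & forall b : 'I_d, (b < a)%N -> k ord0 b = 0.

Lemma lex_pos0 : ~ lex_pos 0.
Proof. by move=> [a]; rewrite mxE ltxx. Qed.

Lemma lex_posD j k : lex_pos j -> lex_pos k -> lex_pos (j + k).
Proof.
move=> [a ja j0] [b kb k0]; have [ab|ba|ab] := ltngtP a b.
- exists a; first by rewrite mxE k0// addr0.
  by move=> c ca; rewrite mxE j0// k0// (ltn_trans ca).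
- exists b; first by rewrite mxE j0// add0r.
  by move=> c cb; rewrite mxE k0// j0// (ltn_trans cb).
- exists a; first by rewrite mxE addr_gt0// (_ : a = b)//; exact: val_inj.
  by move=> c ca; rewrite mxE j0// k0// -ab.
Qed.

Lemma lex_pos_total k : k != 0 -> lex_pos k \/ lex_pos (- k).
Proof.
move=> k0.
have /existsP[a0 ka0] : [exists a : 'I_d, k ord0 a != 0].
  apply: contraNT k0; rewrite negb_exists => /forallP k0; apply/eqP/rowP => a.
  by rewrite [RHS]mxE; apply/eqP/negPn.
case: (@arg_minnP _ a0 (fun a : 'I_d => k ord0 a != 0) (fun a => val a) ka0) => a ka amin.
have h (b : 'I_d) : (b < a)%N -> k ord0 b = 0.
  by move=> ba; apply/eqP/negPn/negP => /amin; rewrite leqNgt ba.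
move: ka; rewrite neq_lt => /orP[ka|ka]; [right|left]; exists a => //.
  by rewrite mxE oppr_gt0.
by move=> b ba; rewrite mxE h// oppr0.
Qed.

End lexicographic.

Section first_maximum.
Context {R : realType} {d : nat}.
Notation config := (config R d).
Implicit Types (x : config) (i j k : site d).

Definition beats x i j : Prop :=
  `|x j| < `|x i| \/ `|x i| = `|x j| /\ lex_pos (j - i).

Definition firstmax x k : Prop := forall j, j = k \/ beats x k j.

Lemma beats_trans x i j k : beats x i j -> beats x j k -> beats x i k.
Proof.
move=> [ij|[ij lij]] [jk|[jk ljk]].
- by left; exact: lt_trans ij.
- by left; rewrite -jk.
- by left; rewrite ij.
- right; split; first by rewrite ij.
  by rewrite (_ : k - i = (j - i) + (k - j)); [exact: lex_posD|rewrite [RHS]addrC subrKA].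
Qed.

Lemma beats_irr x i : ~ beats x i i.
Proof. by move=> [|[_]]; [rewrite ltxx|rewrite subrr => /lex_pos0]. Qed.

Lemma beats_total x i j : i = j \/ beats x i j \/ beats x j i.
Proof.
have [->|ij] := eqVneq i j; first by left.
right; have [xij|xij|xij] := ltgtP `|x i| `|x j|; [by right; left|by left; left|].
have := @lex_pos_total _ (j - i); rewrite subr_eq0 eq_sym => /(_ ij) [l|l].
  by left; right.
by right; right; split => //; rewrite -opprB.
Qed.

Lemma firstmax_unique x i j : firstmax x i -> firstmax x j -> i = j.
Proof.
move=> /(_ j)[//|ij] /(_ i)[//|ji].
by exfalso; exact: (beats_irr (beats_trans ij ji)).
Qed.

Lemma firstmax_ge x k j : firstmax x k -> `|x j| <= `|x k|.
Proof. by move=> /(_ j)[->//|[/ltW//|[->]]]. Qed.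

Lemma supnorm_firstmax x k : firstmax x k -> supnorm x = `|x k|.
Proof.
move=> xk; apply/eqP; rewrite eq_le; apply/andP; split.
  apply: ge_sup; first by exists `|x k|; exists k.
  by move=> _ [j _ <-]; exact: firstmax_ge.
apply: ub_le_sup; last by exists k.
by exists `|x k| => _ [j _ <-]; exact: firstmax_ge.
Qed.

(** [beats] is a strict total order for each [x], so nonempty finite sets of
    sites have a best element. *)
Lemma seq_best x i (s : seq (site d)) :
  exists2 k, k \in i :: s & forall j, j \in i :: s -> j = k \/ beats x k j.
Proof.
elim: s => [|j s [k ks kbest]].
  by exists i; rewrite ?mem_seq1// => j; rewrite mem_seq1 => /eqP ->; left.
have [kj|[kj|jk]] := beats_total x k j.
- exists k; first by move: ks; rewrite !inE => /orP[->//|->]; rewrite !orbT.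
  move=> l; rewrite !inE => /or3P[li|/eqP lj|ls].
  + by apply: kbest; rewrite inE li.
  + by left; rewrite kj.
  + by apply: kbest; rewrite inE ls orbT.
- exists k; first by move: ks; rewrite !inE => /orP[->//|->]; rewrite !orbT.
  move=> l; rewrite !inE => /or3P[li|/eqP ->|ls].
  + by apply: kbest; rewrite inE li.
  + by right.
  + by apply: kbest; rewrite inE ls orbT.
- exists j; first by rewrite !inE eqxx orbT.
  move=> l; rewrite !inE => /or3P[li|/eqP ->|ls].
  + have [->|kl] : l = k \/ beats x k l by apply: kbest; rewrite inE li.
      by right.
    by right; exact: beats_trans kl.
  + by left.
  + have [->|kl] : l = k \/ beats x k l by apply: kbest; rewrite inE ls orbT.
      by right.
    by right; exact: beats_trans kl.
Qed.

(** Only the finitely many exceedances compete: every other site has modulus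
    at most 1. *)
Lemma firstmax_exists_E0 x : E0 x -> exists2 k, firstmax x k & exceed x k.
Proof.
move=> [x0 /finite_seqP[s es]].
have [k ks kbest] := seq_best x 0 s.
have xk : exceed x k.
  move: ks; rewrite inE => /orP[/eqP ->//|ks].
  by rewrite es.
exists k => // j; have [xj|xj] := ltP 1 `|x j|.
  apply: kbest; rewrite inE; apply/orP; right.
  by have : exceed x j by []; rewrite es.
by right; left; exact: le_lt_trans xk.
Qed.

Lemma firstmax_rescale c x k : 0 < c -> firstmax (rescale c x) k = firstmax x k.
Proof.
move=> c0; have h i j : beats (rescale c x) i j = beats x i j.
  rewrite /beats /rescale !normrM !normfV (gtr0_norm c0) ltr_pM2r ?invr_gt0//.
  congr (_ \/ (_ /\ _)); apply/propext; split => [|->//].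
  by move/(congr1 ( *%R^~ c)); rewrite !divfK ?gt_eqF.
by apply/propext; split => H j; have := H j; rewrite h.
Qed.

Lemma firstmax_shift k x i : firstmax (site_shift k x) i = firstmax x (i + k).
Proof.
have h a b : beats (site_shift k x) a b = beats x (a + k) (b + k).
  by rewrite /beats !shiftE opprD addrACA subrr addr0.
apply/propext; split => H j.
  have := H (j - k); rewrite h subrK => -[<-|]; last by right.
  by left; rewrite subrK.
by have [/addIr ->|] := H (j + k); [left|rewrite h; right].
Qed.

(** Existence of a first maximum is invariant under scaling, so the finite
    case [E0] covers [l0] once the value at the origin is made larger than 1. *)
Lemma l0_E0_rescale x : l0 x -> x 0 != 0 -> E0 (rescale (`|x 0| / 2) x).
Proof.
move=> xl x0; split; last by apply: l0_finite_exceed; exact: l0_rescale.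
have n0 : 0 < `|x 0| by rewrite normr_gt0.
rewrite /rescale normrM normfV (gtr0_norm (divr_gt0 n0 _))// ltr_pdivlMr ?divr_gt0// mul1r.
by rewrite ltr_pdivrMr// ltr_pMr// ltr1n.
Qed.

Lemma firstmax_exists_l0 x : l0 x -> x 0 != 0 -> exists k, firstmax x k.
Proof.
move=> xl x0; have [k + _] := firstmax_exists_E0 (l0_E0_rescale xl x0).
by rewrite firstmax_rescale ?divr_gt0 ?normr_gt0//; exists k.
Qed.

Lemma measurable_firstmax k : measurable [set x : config | firstmax x k].
Proof.
apply: measurable_forall => j.
have [->|jk] := eqVneq j k.
  rewrite [X in measurable X](_ : _ = setT)//.
  by apply/seteqP; split => // x _; left.
have [l|l] := pselect (lex_pos (j - k)).
  rewrite [X in measurable X](_ : _ = [set x : config | `|x j| <= `|x k|]).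
    by apply: measurable_le_set; exact: measurable_norm_coord.
  apply/seteqP; split => x /=.
    by move=> [/eqP|[/ltW//|[->]]]; rewrite ?(negbTE jk).
  by rewrite le_eqVlt => /orP[/eqP e|]; right; [right|left].
rewrite [X in measurable X](_ : _ = [set x : config | `|x j| < `|x k|]).
  by apply: measurable_lt_set; exact: measurable_norm_coord.
apply/seteqP; split => x /=.
  by move=> [/eqP|[//|[_ /l]]]; rewrite ?(negbTE jk).
by right; left.
Qed.

Definition first_maximizer x : site d := xget 0 [set k | firstmax x k].

Lemma first_maximizerE x k : firstmax x k -> first_maximizer x = k.
Proof.
move=> xk; apply/esym/(firstmax_unique xk).
have h : exists i, [set i | firstmax x i] i by exists k.
exact: (xgetPex 0 h).
Qed.

(** The first maximum is an exceedance since some exceedance exists, and it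
    moves along with shifts because [beats] depends on differences of sites. *)
Lemma anchoring_first_maximizer : anchoring first_maximizer.
Proof.
split.
- move=> B.
  have -> : @E0 R d `&` first_maximizer @^-1` B =
      @E0 R d `&` [set x | exists k : site d, B k /\ firstmax x k].
    apply/seteqP; split => x /= [xE].
      have [k xk _] := firstmax_exists_E0 xE.
      by rewrite (first_maximizerE xk) => Bk; split => //; exists k.
    by move=> [k [Bk /first_maximizerE ->]].
  apply: measurableI; first exact: measurable_E0.
  apply: measurable_exists => k.
  have [Bk|Bk] := pselect (B k).
    rewrite [X in measurable X](_ : _ = [set x | firstmax x k]).
      exact: measurable_firstmax.
    by apply/seteqP; split => x //= [].
  by rewrite [X in measurable X](_ : _ = set0)//; apply/seteqP; split => x //= [].
- by move=> x /firstmax_exists_E0[k /first_maximizerE -> ].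
- move=> x /firstmax_exists_E0[i xi _] k _; rewrite (first_maximizerE xi).
  rewrite (@first_maximizerE _ (i - k)) ?subrK//.
  by rewrite firstmax_shift subrK.
Qed.

Lemma firstmax_exists_neq0 x k : l0 x -> x k != 0 -> exists j, firstmax x j.
Proof.
move=> xl xk; have [||j] := @firstmax_exists_l0 (site_shift k x).
- exact: l0_shift.
- by rewrite shiftE add0r.
- by rewrite firstmax_shift; exists (j + k).
Qed.

Definition max_at_origin : set config := [set x | firstmax x 0].

Lemma measurable_max_at_origin : measurable max_at_origin.
Proof. exact: measurable_firstmax. Qed.

Lemma max_at_origin_shift k (x : config) :
  max_at_origin (site_shift k x) = firstmax x k.
Proof. by rewrite /max_at_origin /= firstmax_shift add0r. Qed.

Lemma firstmax_neq0 (x : config) k : x 0 != 0 -> firstmax x k -> 0 < `|x k|.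
Proof. by rewrite -normr_gt0 => x0 /(firstmax_ge 0); exact: lt_le_trans. Qed.

End first_maximum.

(** * Counting exceedances *)

Section exceedance_counts.
Context {R : realType} {d : nat}.
Notation config := (config R d).
Implicit Types (x : config) (k : site d).

(** The number of exceedances as an extended real, so that it can be exchanged
    with integrals. *)
Definition num_exceed x : \bar R :=
  (\esum_(k in [set: site d]) (\1_[set x : config | exceed x k] x)%:E)%E.

Lemma measurable_num_exceed : measurable_fun [set: config] num_exceed.
Proof.
apply: measurable_fun_esum => [k|k x]; last by rewrite lee_fin.
by apply: measurable_EFin_indic; exact: measurable_exceed.
Qed.

Lemma num_exceedE x : finite_set (exceed x) ->
  num_exceed x = (#|` fset_set (exceed x)|%fset%:R : R)%:E.
Proof.
move=> fx; rewrite /num_exceed.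
transitivity (\esum_(k in exceed x) (1 : \bar R))%E.
  rewrite [RHS]esum_mkcond; apply: eq_esum => k _; rewrite indicE.
  have -> : (x \in [set x : config | exceed x k]) = (k \in exceed x).
    by apply/idP/idP; rewrite !inE.
  by case: ifP.
rewrite esum_fset// fsbig_finite//=.
by rewrite sumEFin big_const_seq count_predT iter_addr addr0.
Qed.

Lemma num_exceed_shift k x : num_exceed (site_shift k x) = num_exceed x.
Proof.
rewrite /num_exceed -(esum_shift k (fun i => (\1_[set x : config | exceed x i] x)%:E)).
by apply: eq_esum => i _; rewrite !indicE; congr ((_ : bool)%:R%:E); apply/idP/idP; rewrite !inE.
Qed.

Lemma finite_exceed_shift k x :
  finite_set (exceed (site_shift k x)) = finite_set (exceed x).
Proof.
have h j (y : config) : finite_set (exceed y) -> finite_set (exceed (site_shift j y)).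
  move=> fy; have -> : exceed (site_shift j y) = (fun i => i - j) @` exceed y.
    apply/seteqP; split => i /=; first by move=> yi; exists (i + j); rewrite ?addrK.
    by move=> [l yl <-]; rewrite /exceed /= /site_shift subrK.
  exact: finite_image.
apply/propext; split; last exact: h.
by move=> /(h (- k)); rewrite shift_shift addNr shift0.
Qed.

(** With infinitely many exceedances both sides are 0: [fset_set] of an infinite
    set is empty, and the indicator vanishes. *)
Lemma inv_card_exceedE x : inv_card_exceed x =
  \1_[set x : config | finite_set (exceed x)] x * (fine (num_exceed x))^-1.
Proof.
have [fx|fx] := pselect (finite_set (exceed x)).
  by rewrite indicE mem_set// mul1r num_exceedE.
rewrite indicE memNset// mul0r /inv_card_exceed /fset_set.
by case: pselect => // _; rewrite cardfs0 invr0.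
Qed.

Lemma num_exceed_ge0 x : (0 <= num_exceed x)%E.
Proof. by apply: esum_ge0 => k _; rewrite lee_fin. Qed.

Lemma measurable_inv_card_exceed :
  measurable_fun [set: config] (@inv_card_exceed R d).
Proof.
apply: (eq_measurable_fun (fun x : config => \1_[set x : config | finite_set (exceed x)] x *
    (fine (num_exceed x))^-1 : R)) => [x _|]; first by rewrite inv_card_exceedE.
apply: measurable_funM; first by apply: measurable_indic; exact: measurable_finite_exceed.
apply: measurable_fun_inv_ge0; first by move=> x; rewrite fine_ge0// num_exceed_ge0.
exact: (measurableT_comp (fine_measurable _) measurable_num_exceed).
Qed.

Lemma inv_card_exceed_ge0 x : 0 <= inv_card_exceed x.
Proof. by rewrite invr_ge0. Qed.

Lemma inv_card_exceed_shift k x : inv_card_exceed (site_shift k x) = inv_card_exceed x.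
Proof.
rewrite !inv_card_exceedE num_exceed_shift; congr (_ * _).
by rewrite !indicE; congr ((_ : bool)%:R); apply/idP/idP; rewrite !inE /= finite_exceed_shift.
Qed.

Lemma inv_card_exceedK x k : finite_set (exceed x) -> exceed x k ->
  ((inv_card_exceed x)%:E * num_exceed x = 1)%E.
Proof.
move=> fx xk; rewrite num_exceedE// -EFinM mulVf// pnatr_eq0 cardfs_eq0.
by apply/eqP => e; have := in_fset_set fx k; rewrite e in_fset0 mem_set.
Qed.

End exceedance_counts.

(** * The supremum norm and functions on l0 *)

Section normalization.
Context {R : realType} {d : nat}.
Notation config := (config R d).
Implicit Types (x : config) (k : site d).

Definition bounded_config : set config :=
  [set x | exists n : nat, forall i, `|x i| <= n%:R].

Lemma measurable_bounded_config : measurable bounded_config.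
Proof.
apply: measurable_exists => n; apply: measurable_forall => i.
by apply: measurable_le_set; [exact: measurable_norm_coord|exact: measurable_cst].
Qed.

Lemma supnorm_gt x a : bounded_config x ->
  (a < supnorm x) <-> (exists i, a < `|x i|).
Proof.
move=> [n xn].
have hs : has_sup (range (fun i => `|x i|)).
  by split; [exists `|x 0|; exists 0|exists n%:R => _ [i _ <-]].
split; last first.
  move=> [i /lt_le_trans]; apply; apply: ub_le_sup; last by exists i.
  by case: hs.
move=> ax; have [_ [i _ <-] h] := sup_gt (proj1 hs) ax.
by exists i.
Qed.

Lemma supnorm_unbounded x : ~ bounded_config x -> supnorm x = 0.
Proof.
move=> nb; apply: sup_out => -[_ [M xM]]; apply: nb.
exists (Num.truncn M).+1 => i; apply: (@le_trans _ _ M); first by apply: xM; exists i.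
exact/ltW/truncnS_gt.
Qed.

Lemma supnorm_ge0 x : 0 <= supnorm x.
Proof.
have [xb|xb] := pselect (bounded_config x); last by rewrite supnorm_unbounded.
have [n xn] := xb.
apply: (@le_trans _ _ `|x 0|) => //; apply: ub_le_sup; last by exists 0.
by exists n%:R => _ [i _ <-].
Qed.

(** On bounded configurations the supremum exceeds [a] when some coordinate
    does; on the others it is 0 by convention. *)
Lemma measurable_supnorm : measurable_fun [set: config] (@supnorm R d).
Proof.
refine (measurability _ (RGenOInfty.measurableE R) _) => _ [_ [a ->] <-].
rewrite setTI; have [a0|a0] := ltP a 0.
  rewrite [X in measurable X](_ : _ = setT)//.
  apply/seteqP; split => x //= _; rewrite in_itv /= andbT.
  by rewrite (lt_le_trans a0)// supnorm_ge0.
rewrite [X in measurable X](_ : _ = bounded_config `&`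
   [set x | exists i : site d, a < `|x i|]).
  apply: measurableI; first exact: measurable_bounded_config.
  apply: measurable_exists => i.
  by apply: measurable_lt_set; [exact: measurable_cst|exact: measurable_norm_coord].
apply/seteqP; split => x /=; rewrite in_itv /= andbT.
  move=> ax; have xb : bounded_config x.
    by apply: contrapT => /supnorm_unbounded x0; move: ax; rewrite x0 ltNge a0.
  by split => //; apply/supnorm_gt.
by move=> [xb xi]; apply/supnorm_gt.
Qed.

Lemma supnorm_shift k x : supnorm (site_shift k x) = supnorm x.
Proof.
congr sup; apply/seteqP; split => _ [i _ <-].
  by exists (i + k).
by exists (i - k) => //; rewrite /site_shift subrK.
Qed.

Definition normalize x : config := rescale (supnorm x) x.

Lemma measurable_normalize : measurable_fun [set: config] normalize.
Proof.
exact: (@measurable_rescale R d _ config (@supnorm R d) id supnorm_ge0 measurable_supnorm).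
Qed.

Lemma normalize_shift k x : normalize (site_shift k x) = site_shift k (normalize x).
Proof. by rewrite /normalize supnorm_shift. Qed.

(** A first maximum makes the supremum an attained one, hence homogeneous. *)
Lemma normalize_rescale c k x : 0 < c -> firstmax x k ->
  normalize (rescale c x) = normalize x.
Proof.
move=> c0 xk; have xk' : firstmax (rescale c x) k by rewrite firstmax_rescale.
rewrite /normalize (supnorm_firstmax xk) (supnorm_firstmax xk') rescale_rescale.
congr rescale; rewrite /rescale normrM normfV (gtr0_norm c0).
by rewrite mulrC divfK// gt_eqF.
Qed.

(** Functions on [l0] are extended by 0, so that expectations over [l0] become
    integrals of globally measurable functions. *)
Definition zero_ext (h : config -> R) x : R := if x \in @l0 R d then h x else 0.

Lemma zero_extE h x : l0 x -> zero_ext h x = h x.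
Proof. by move=> xl; rewrite /zero_ext mem_set. Qed.

Lemma zero_ext_ge0 h x : l0_nneg_measurable h -> 0 <= zero_ext h x.
Proof. by move=> [_ h0]; rewrite /zero_ext; case: ifPn => //; rewrite inE => /h0. Qed.

Lemma measurable_zero_ext h : l0_nneg_measurable h ->
  measurable_fun [set: config] (zero_ext h).
Proof. by move=> [mh _]; exact: ((measurable_restrictT h (@measurable_l0 R d)).1 mh). Qed.

Lemma zero_ext_shift h x k : shift_invariant h -> zero_ext h (site_shift k x) = zero_ext h x.
Proof.
move=> hs; rewrite /zero_ext.
have -> : (site_shift k x \in @l0 R d) = (x \in @l0 R d).
  by apply/idP/idP; rewrite !inE l0_shiftE.
by case: ifPn => //; rewrite inE => xl; rewrite hs.
Qed.

Lemma expect_l0_zero_ext {disp} {T : measurableType disp} (P : probability T R)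
    (V : T -> config) h :
  expect_l0 P V (fun x => (h x)%:E) = (\int[P]_w (zero_ext h (V w))%:E)%E.
Proof.
rewrite /expect_l0 integral_mkcond; apply: eq_integral => w _.
rewrite patchE /zero_ext.
have -> : (w \in V @^-1` @l0 R d) = (V w \in @l0 R d) by apply/idP/idP; rewrite !inE.
by case: ifP.
Qed.

End normalization.

(** * The integrand of the ratio formula *)

Section spectral_ratio.
Context {R : realType} {d : nat}.
Notation config := (config R d).
Variable alpha : R.
Hypothesis alpha0 : 0 < alpha.
Implicit Types (x : config) (k : site d).

(** h(x/|x|) |x|^alpha / sum_k |x_k|^alpha as a real number. It is 0 when the
    sum is infinite, since [fine +oo] and the inverse of 0 are 0. *)
Definition spectral_ratio (h : config -> R) x : R :=
  h (normalize x) * (supnorm x `^ alpha * (fine (sum_power alpha x))^-1).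

Lemma measurable_ratio_weight : measurable_fun [set: config]
  (fun x => supnorm x `^ alpha * (fine (sum_power alpha x))^-1).
Proof.
apply: measurable_funM.
  exact: (measurableT_comp (measurable_powR alpha) measurable_supnorm).
apply: measurable_fun_inv_ge0; first by move=> x; rewrite fine_ge0// sum_power_ge0.
exact: (measurableT_comp (fine_measurable _) (measurable_sum_power alpha)).
Qed.

Lemma l0_normalize x : l0 x -> l0 (normalize x).
Proof. exact: l0_rescale. Qed.

Lemma spectral_ratio_l0_nneg_measurable h : l0_nneg_measurable h ->
  l0_nneg_measurable (spectral_ratio h).
Proof.
move=> mh; split; last first.
  move=> x xl; apply: mulr_ge0; first by case: mh => _; apply; exact: l0_normalize.
  by rewrite mulr_ge0 ?powR_ge0// invr_ge0 fine_ge0// sum_power_ge0.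
apply: (eq_measurable_fun (fun x : config => zero_ext h (normalize x) *
    (supnorm x `^ alpha * (fine (sum_power alpha x))^-1) : R)).
  move=> x; rewrite inE => xl; rewrite /spectral_ratio zero_extE//.
  exact: l0_normalize.
apply: measurable_funTS; apply: measurable_funM; last exact: measurable_ratio_weight.
exact: (measurableT_comp (measurable_zero_ext mh) measurable_normalize).
Qed.

(** Extended and real division differ only when the sum of powers is 0, but
    then [x] is 0 and so is the numerator. *)
Lemma spectral_ratioE h x : l0 x ->
  ((h (rescale (supnorm x) x))%:E * ((supnorm x `^ alpha)%:E / sum_power alpha x) =
   (spectral_ratio h x)%:E)%E.
Proof.
move=> xl; rewrite /spectral_ratio EFinM EFinM; congr (_ * _)%E.
have := sum_power_ge0 alpha x; case ES : (sum_power alpha x) => [s| |] //=; last first.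
  by rewrite invey mule0 invr0 mule0.
rewrite lee_fin le_eqVlt => /predU1P[s0|s0]; last by rewrite inver gt_eqF.
suff -> : supnorm x = 0 by rewrite powR0 ?gt_eqF// !mul0e.
have x0 i : x i = 0.
  apply/eqP; rewrite -normr_eq0 eq_le normr_ge0 andbT leNgt; apply/negP => xi.
  have := sum_power_ge alpha i x; rewrite ES -s0 lee_fin leNgt.
  by rewrite powR_gt0.
apply/eqP; rewrite eq_le supnorm_ge0 andbT; apply: ge_sup; first by exists `|x 0|; exists 0.
by move=> _ [i _ <-]; rewrite x0 normr0.
Qed.

(** Numerator and denominator are both homogeneous of degree alpha and
    shift-invariant. *)
Lemma spectral_ratio_recenter h x j k : l0 x -> shift_invariant h ->
  firstmax x j -> x k != 0 -> spectral_ratio h (recenter k x) = spectral_ratio h x.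
Proof.
move=> xl hs xj xk; rewrite recenterE.
have n0 : 0 < `|x k| by rewrite normr_gt0.
have xj' : firstmax (site_shift k x) (j - k) by rewrite firstmax_shift subrK.
rewrite /spectral_ratio (normalize_rescale n0 xj') normalize_shift.
rewrite hs; last exact: l0_normalize.
congr (_ * _).
have xj2 : firstmax (rescale `|x k| (site_shift k x)) (j - k) by rewrite firstmax_rescale.
rewrite (supnorm_firstmax xj2) (supnorm_firstmax xj) sum_power_rescale// sum_power_shift.
rewrite /rescale /site_shift subrK normrM normfV normr_id powRM ?invr_ge0//.
have -> : `|x k|^-1 `^ alpha = `|x k| `^ (- alpha).
  by rewrite -powR_inv1// -powRrM mulN1r.
set c := _ `^ (- alpha); have c0 : 0 < c by exact: powR_gt0.
have -> : fine (c%:E * sum_power alpha x) = c * fine (sum_power alpha x).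
  have := sum_power_ge0 alpha x; case: (sum_power alpha x) => [s| |] //= _.
  by rewrite gt0_muley ?lte_fin//= mulr0.
by rewrite invfM mulrA mulfK ?gt_eqF.
Qed.

(** By [spectral_ratio_recenter] the ratio comes out of the sum, and what is
    left of the sum is exactly its denominator. *)
Lemma esum_spectral_ratio h x j : l0 x -> shift_invariant h -> l0_nneg_measurable h ->
  firstmax x j -> x j != 0 -> (sum_power alpha x < +oo)%E ->
  (\esum_(k in [set: site d])
     ((zero_ext (spectral_ratio h) (recenter k x))%:E * (`|x k| `^ alpha)%:E) =
   (h (normalize x) * supnorm x `^ alpha)%:E)%E.
Proof.
move=> xl hs mh xj xj0 Sx.
have r0 : 0 <= spectral_ratio h x.
  by have [_] := spectral_ratio_l0_nneg_measurable mh; apply.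
transitivity (\esum_(k in [set: site d]) ((spectral_ratio h x)%:E * (`|x k| `^ alpha)%:E))%E.
  apply: eq_esum => k _; have [->|xk] := eqVneq (x k) 0.
    by rewrite normr0 powR0 ?gt_eqF// !mule0.
  rewrite zero_extE; first by rewrite (spectral_ratio_recenter xl hs xj xk).
  by rewrite recenterE; apply: l0_rescale; exact: l0_shift.
rewrite ge0_esumZl ?lee_fin//.
rewrite -/(sum_power alpha x) /spectral_ratio.
have Sp : (0 < sum_power alpha x)%E.
  by apply: lt_le_trans (sum_power_ge alpha j x); rewrite lte_fin powR_gt0// normr_gt0.
case ES : (sum_power alpha x) Sp Sx => [s| |] //= s0 _.
rewrite -EFinM; congr EFin; rewrite !mulrA divfK// gt_eqF//.
Qed.

End spectral_ratio.

(** * Open cylinders and their continuous approximations *)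

Section bumps.
Context {R : realType} {d : nat}.
Notation config := (config R d).

(** Continuity is bundled with the function so that lists of constraints need
    no side condition. *)
Definition continuous_fun := {g : R -> R | continuous g}.
Definition constraints := seq (site d * continuous_fun).

Definition clamp (t : R) : R := Num.min 1 (Num.max 0 t).

(** A continuous function of finitely many coordinates. As [n] grows it
    increases to the indicator of the open cylinder [positive_on s]. *)
Definition bump (n : nat) (s : constraints) (x : config) : R :=
  \prod_(p <- s) clamp (n%:R * sval p.2 (x p.1)).

Definition positive_on (s : constraints) : set config :=
  [set x | all (fun p => 0 < sval p.2 (x p.1)) s].

Lemma clamp_ge0 t : 0 <= clamp t.
Proof. by rewrite /clamp le_min ler01 le_max lexx. Qed.

Lemma clamp_le1 t : clamp t <= 1.
Proof. by rewrite /clamp ge_min lexx. Qed.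

Lemma clamp_nondecreasing : {homo clamp : s t / s <= t}.
Proof.
move=> s t st; rewrite /clamp le_min ge_min lexx /= ge_min ge_max !le_max lexx /=.
by rewrite st !orbT.
Qed.

Lemma clamp_le0 t : t <= 0 -> clamp t = 0.
Proof. by move=> t0; rewrite /clamp max_l// min_r. Qed.

Lemma clamp_ge1 t : 1 <= t -> clamp t = 1.
Proof. by move=> t1; rewrite /clamp max_r ?(le_trans ler01)// min_l. Qed.

Lemma clamp_continuous : continuous clamp.
Proof.
move=> t; apply: (@continuous_min R R^o (fun=> 1) (Num.max 0)); first exact: cvg_cst.
by apply: (@continuous_max R R^o (fun=> 0) id); [exact: cvg_cst|exact: cvg_id].
Qed.

Lemma bump_ge0 n s x : 0 <= bump n s x.
Proof. by apply: prodr_ge0 => p _; exact: clamp_ge0. Qed.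

Lemma bump_le1 n s x : bump n s x <= 1.
Proof.
rewrite /bump; elim: s => [|p s IH]; first by rewrite big_nil.
by rewrite big_cons mulr_ile1 ?clamp_ge0 ?clamp_le1 //; exact: bump_ge0.
Qed.

Lemma bump_outside n s x : ~ positive_on s x -> bump n s x = 0.
Proof.
rewrite /positive_on /= /bump; elim: s => [//|p s IH] /=; rewrite big_cons.
have [p0|p0] := ltP 0 (sval p.2 (x p.1)) => /=; last first.
  by rewrite clamp_le0 ?mul0r// mulr_ge0_le0.
by move=> /IH ->; rewrite mulr0.
Qed.

Lemma bump_nondecreasing s x : nondecreasing_seq (fun n => bump n s x).
Proof.
move=> m n mn; have [xs|xs] := pselect (positive_on s x); last first.
  by rewrite !bump_outside.
rewrite /bump; elim: s xs => [|p s IH]; first by rewrite !big_nil.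
rewrite /positive_on /= => /andP[p0 xs]; rewrite !big_cons.
apply: ler_pM; [exact: clamp_ge0|exact: bump_ge0| |exact: IH].
by apply: clamp_nondecreasing; rewrite ler_wpM2r ?ler_nat// ltW.
Qed.

Lemma bump_eventually1 s x : positive_on s x -> \forall n \near \oo, bump n s x = 1.
Proof.
rewrite /bump /positive_on /=; elim: s => [_|p s IH /= /andP[p0 /IH xs]].
  by apply: nearW => n; rewrite big_nil.
near=> n; rewrite big_cons (_ : clamp _ = 1) ?mul1r; first by near: n.
apply: clamp_ge1; rewrite -ler_pdivrMr// mul1r.
by near: n; exact: nbhs_infty_ger.
Unshelve. all: by end_near. Qed.

Lemma bump_cvg s x : bump n s x @[n --> \oo] --> (\1_(positive_on s) x : R).
Proof.
have [xs|xs] := pselect (positive_on s x).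
  rewrite indicE mem_set//=; apply: cvg_near_cst.
  exact: bump_eventually1.
rewrite indicE memNset//=; under eq_cvg do rewrite bump_outside//.
exact: cvg_cst.
Qed.

Lemma measurable_continuous_fun (g : continuous_fun) i :
  measurable_fun [set: config] (fun x => sval g (x i)).
Proof.
apply: (measurableT_comp (f := sval g)); last exact: measurable_coord.
exact: continuous_measurable_fun (svalP g).
Qed.

Lemma measurable_positive_on s : measurable (positive_on s).
Proof.
elim: s => [|p s IH].
  by rewrite [X in measurable X](_ : _ = setT)//; apply/seteqP; split.
rewrite [X in measurable X](_ : _ =
  [set x : config | 0 < sval p.2 (x p.1)] `&` positive_on s).
  apply: measurableI => //; apply: measurable_lt_set; first exact: measurable_cst.
  exact: measurable_continuous_fun.
by apply/seteqP; split => x /= => [/andP[]//|[? ?]]; apply/andP.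
Qed.

Lemma measurable_bump n s : measurable_fun [set: config] (bump n s).
Proof.
elim: s => [|p s IH].
  apply: (eq_measurable_fun (cst 1 : config -> R)) => [x _|]; first by rewrite /bump big_nil.
  exact: measurable_cst.
apply: (eq_measurable_fun (fun x : config =>
  clamp (n%:R * sval p.2 (x p.1)) * bump n s x)) => [x _|].
  by rewrite /bump big_cons.
apply: measurable_funM => //.
apply: (measurableT_comp (continuous_measurable_fun clamp_continuous)).
apply: measurable_funM; [exact: measurable_cst|exact: measurable_continuous_fun].
Qed.

Lemma integral_bump_cvg d' (T : measurableType d') (mu : {measure set T -> \bar R})
    (V : T -> config) s : measurable_fun [set: T] V ->
  (\int[mu]_w (bump n s (V w))%:E)%E @[n --> \oo] --> mu (V @^-1` positive_on s).
Proof.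
move=> mV.
have := @cvg_monotone_convergence _ _ R mu _ measurableT
  (fun n w => (bump n s (V w))%:E).
rewrite (_ : (\int[mu]_(x in _) _)%E = mu (V @^-1` positive_on s)); last first.
  rewrite -[in RHS](setIT (V @^-1` _)) -integral_indic//; last first.
    exact: measurable_preimage_setT mV (measurable_positive_on s).
  apply: eq_integral => w _; apply/cvg_lim => //.
  apply: cvg_EFin; first exact: nearW.
  rewrite [X in _ --> X](_ : _ = \1_(positive_on s) (V w)); last by rewrite !indicE.
  exact: bump_cvg.
apply.
- move=> n; apply/measurable_EFinP.
  exact: (measurableT_comp (measurable_bump n s)).
- by move=> n w _; rewrite lee_fin bump_ge0.
- by move=> w _ m n mn; rewrite lee_fin; exact: bump_nondecreasing.
Qed.

Definition ray_fun (a : R) : continuous_fun.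
Proof. by exists (fun t => t - a) => t; apply: cvgB; [exact: cvg_id|exact: cvg_cst]. Defined.

(** Half lines generate the Borel sets, so open cylinders generate the product
    sigma-algebra. *)
Lemma measurable_positive_onE :
  @measurable _ config = <<s [set positive_on s | s in [set: constraints]] >>.
Proof.
pose G := [set positive_on s | s in [set: constraints]].
apply/seteqP; split; last first.
  apply: smallest_sub; first exact: sigma_algebra_measurable.
  by move=> _ [s _ <-]; exact: measurable_positive_on.
apply: smallest_sub; first exact: smallest_sigma_algebra.
move=> _ [i [B mB ->]].
have mi : measurable_fun [set: g_sigma_algebraType G]
    (fun x : g_sigma_algebraType G => (x : config) i).
  refine (measurability _ (RGenOInfty.measurableE R) _) => _ [_ [a ->] <-].
  rewrite setTI; apply: sub_sigma_algebra.
  exists [:: (i, ray_fun a)] => //.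
  by apply/seteqP; split => x; rewrite /positive_on /= andbT subr_gt0 in_itv /= andbT.
by have := mi measurableT B mB; rewrite setTI.
Qed.

(** Open cylinders form a pi-system: concatenating constraints intersects the
    cylinders. *)
Lemma config_measure_unique (m1 m2 : {measure set config -> \bar R}) :
  (m1 [set: config] < +oo)%E ->
  (forall s, m1 (positive_on s) = m2 (positive_on s)) ->
  forall B, measurable B -> m1 B = m2 B.
Proof.
move=> m1oo m12 B mB.
have T0 : positive_on [::] = setT by apply/seteqP; split.
apply: (measure_unique [set positive_on s | s in [set: constraints]] (fun=> setT)) => //.
- exact: measurable_positive_onE.
- move=> _ _ [s _ <-] [t _ <-]; exists (s ++ t) => //.
  by apply/seteqP; split => x; rewrite /positive_on /= all_cat => /andP.
- by move=> _; exists [::].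
- by rewrite bigcup_const.
- by move=> _ [s _ <-]; exact: m12.
Qed.

End bumps.

(** * Comparing laws, restricting to windows *)

Section laws.
Context {R : realType} {d : nat}.
Notation config := (config R d).
Context {d1 d2 : measure_display} {T1 : measurableType d1} {T2 : measurableType d2}.

Definition mfun_of d (T : measurableType d) (d' : measure_display)
  (T' : measurableType d') (f : T -> T') (mf : measurable_fun [set: T] f) :
  {mfun T >-> T'} := mfun_Sub (mem_set mf).

(** The pi-lambda principle for two laws restricted to [D], one of them up to
    a constant factor. *)
Lemma law_unique (P1 : probability T1 R) (P2 : probability T2 R)
    (V1 : T1 -> config) (V2 : T2 -> config) (D : set config) (c : {nonneg R}) :
  measurable_fun [set: T1] V1 -> measurable_fun [set: T2] V2 -> measurable D ->
  (forall s, P1 (V1 @^-1` (positive_on s `&` D)) =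
     (c%:num%:E * P2 (V2 @^-1` (positive_on s `&` D)))%E) ->
  forall B, measurable B ->
    P1 (V1 @^-1` (B `&` D)) = (c%:num%:E * P2 (V2 @^-1` (B `&` D)))%E.
Proof.
move=> mV1 mV2 mD h B mB.
pose m1 := mrestr (distribution P1 (mfun_of mV1)) mD.
pose m2 := mscale c (mrestr (distribution P2 (mfun_of mV2)) mD).
have : m1 B = m2 B.
  apply: config_measure_unique => //.
  rewrite /m1 /= /mrestr /= /distribution /pushforward /= setTI.
  apply: (@le_lt_trans _ _ 1%E); last exact: ltry.
  by apply: probability_le1; exact: measurable_preimage_setT.
by [].
Qed.

(** Laws that agree on the measurable subsets of [D] integrate functions on
    [D] alike. *)
Lemma law_integral (P1 : probability T1 R) (P2 : probability T2 R)
    (V1 : T1 -> config) (V2 : T2 -> config) (D : set config) (F : config -> \bar R) :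
  measurable_fun [set: T1] V1 -> measurable_fun [set: T2] V2 -> measurable D ->
  (forall B, measurable B -> B `<=` D -> P1 (V1 @^-1` B) = P2 (V2 @^-1` B)) ->
  measurable_fun [set: config] F -> (forall x, 0 <= F x)%E ->
  (\int[P1]_(w in V1 @^-1` D) F (V1 w) = \int[P2]_(w in V2 @^-1` D) F (V2 w))%E.
Proof.
move=> mV1 mV2 mD h mF F0.
have H := @ge0_integral_pushforward _ _ T1 config R V1 mV1 P1 D F mD.
rewrite -[LHS]H ; [|exact: measurable_funTS|by move=> *; exact: F0].
have H2 := @ge0_integral_pushforward _ _ T2 config R V2 mV2 P2 D F mD.
rewrite -[RHS]H2 ; [|exact: measurable_funTS|by move=> *; exact: F0].
by apply: eq_measure_integral => A mA AD; exact: h.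
Qed.

End laws.

Section windows.
Context {R : realType} {d : nat}.
Notation config := (config R d).

(** Filling a window with zeros outside makes a bump a function of the window
    only, as the definition of a tail process requires of test functions. *)
Definition extend_window m (z : {ptws window d m -> R}) : config :=
  fun i => if insub i is Some j then z j else 0.

Lemma extend_restrict_window m (x : config) i : (site_norm i <= m)%N ->
  extend_window (restrict_window (m := m) x) i = x i.
Proof. by move=> im; rewrite /extend_window insubT. Qed.

Lemma window_eval_continuous m (j : window d m) :
  continuous (fun z : {ptws window d m -> R} => z j).
Proof.
have H := @proj_continuous (window d m) (fun _ : window d m => R : topologicalType) j.
exact: H.
Qed.

Lemma extend_window_continuous m i :
  continuous (fun z : {ptws window d m -> R} => extend_window z i).
Proof.
suff h (o : option (window d m)) : continuous
    (fun z : {ptws window d m -> R} => if o is Some j then z j else 0) by exact: h.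
case: o => [j|]; first exact: window_eval_continuous.
have H := @cst_continuous {ptws window d m -> R} R 0.
exact H.
Qed.

Lemma bump_extend_continuous m n s :
  continuous (fun z : {ptws window d m -> R} => bump n s (extend_window z)).
Proof.
elim: s => [|p s IH].
  have H := @cst_continuous {ptws window d m -> R} R 1.
  rewrite (_ : (fun z => _) = cst 1); first exact H.
  by apply/funext => z; rewrite /bump big_nil.
rewrite (_ : (fun z => _) = (fun z : {ptws window d m -> R} =>
    clamp (n%:R * (sval p.2) (extend_window z p.1)) * bump n s (extend_window z))); last first.
  by apply/funext => z; rewrite /bump big_cons.
have H i : continuous (fun z : {ptws window d m -> R} => extend_window z i).
  exact: extend_window_continuous.
have H1 : continuous (fun z : {ptws window d m -> R} => sval p.2 (extend_window z p.1)).
  move=> z; apply: continuous_comp; first exact: H.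
  exact: (svalP p.2).
have H2 : continuous (fun z : {ptws window d m -> R} =>
    clamp (n%:R * sval p.2 (extend_window z p.1))).
  have C : continuous (fun t : R => clamp (n%:R * t)).
    move=> t; apply: continuous_comp; first exact: mulrl_continuous.
    exact: clamp_continuous.
  move=> z; exact: (continuous_comp (H1 z) (C _)).
by move=> z; have H3 := continuousM (H2 z) (IH z); exact H3.
Qed.

Definition constraint_radius (s : @constraints R d) : nat :=
  \max_(p <- s) site_norm p.1.

Lemma bump_extend_restrict n s (x : config) :
  bump n s (extend_window (restrict_window (m := constraint_radius s) x)) =
  bump n s x.
Proof.
suff h m : (constraint_radius s <= m)%N ->
    bump n s (extend_window (restrict_window (m := m) x)) = bump n s x by exact: h.
rewrite /bump /constraint_radius; elim: s => [|p s IH]; first by rewrite !big_nil.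
rewrite !big_cons geq_max => /andP[pm /IH ->].
by rewrite extend_restrict_window.
Qed.

End windows.

(** * Constraints under shifts and scalings *)

Section constraint_transport.
Context {R : realType} {d : nat}.
Notation config := (config R d).

Definition norm_gt_fun (a : R) : @continuous_fun R.
Proof.
exists (fun t => `|t| - a) => t; apply: cvgB; last exact: cvg_cst.
exact: norm_continuous.
Defined.

Definition exceeds (i : site d) (a : R) : site d * continuous_fun := (i, norm_gt_fun a).

Definition scale_fun (c : R) (g : @continuous_fun R) : @continuous_fun R.
Proof.
exists (fun t => sval g (t / c)) => t.
have H : continuous (fun u : R => u / c) by exact: mulrr_continuous.
exact: (continuous_comp (H t) (svalP g _)).
Defined.

Definition shift_constraints k (s : @constraints R d) : constraints :=
  [seq (p.1 + k, p.2) | p <- s].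

Definition scale_constraints c (s : @constraints R d) : constraints :=
  [seq (p.1, scale_fun c p.2) | p <- s].

Lemma bump_shift n k s (x : config) :
  bump n (shift_constraints k s) x = bump n s (site_shift k x).
Proof. by rewrite /bump big_map. Qed.

Lemma bump_rescale n c s (x : config) :
  bump n (scale_constraints c s) x = bump n s (rescale c x).
Proof. by rewrite /bump big_map. Qed.

Lemma positive_on_rescale c s (x : config) :
  positive_on (scale_constraints c s) x = positive_on s (rescale c x).
Proof. by rewrite /positive_on /= all_map. Qed.

Lemma positive_on_cons i g s : positive_on ((i, g) :: s) =
  positive_on s `&` [set x : config | 0 < sval g (x i)].
Proof.
apply/seteqP; split => x; rewrite /positive_on /=; first by move=> /andP[].
by move=> [? ?]; apply/andP.
Qed.

Lemma positive_on_nil : positive_on [::] = [set: config].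
Proof. by apply/seteqP; split. Qed.

Definition origin_above (y : R) : set config := [set x | y < `|x 0|].

Lemma measurable_origin_above y : measurable (origin_above y).
Proof.
by apply: measurable_lt_set; [exact: measurable_cst|exact: measurable_norm_coord].
Qed.

End constraint_transport.

(** * What weak convergence says about a tail process *)

Section tail_process_laws.
Context {R : realType} {d : nat}.
Notation config := (config R d).
Context {dispX : measure_display} {TX : measurableType dispX}
  (PX : probability TX R) (X : {RV PX >-> config}).
Context {disp : measure_display} {T : measurableType disp}
  (P : probability T R) (Y : {RV P >-> config}).
Hypothesis stX : stationary X.
Hypothesis tailXY : tail_process_of X Y.

Let mX : measurable_fun [set: TX] X. Proof. exact: measurable_funP. Qed.
Let mY : measurable_fun [set: T] Y. Proof. exact: measurable_funP. Qed.

Let excX u : set TX := [set w | u < `|X w 0|].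

Let mean_bump n s u : \bar R := (\int[PX]_w (bump n s (rescale u (X w)))%:E)%E.

(** For a bump that vanishes unless |x_0| > 1, the restriction of the integral
    to |X_0| > u may be dropped, so the numerators become plain integrals,
    to which stationarity and changes of threshold apply. *)
Lemma tail_bump_cvg n s : (forall x, positive_on s x -> 1 < `|x 0|) ->
  (mean_bump n s u / PX (excX u))%E @[u --> +oo]
  --> (\int[P]_w (bump n s (Y w))%:E)%E.
Proof.
move=> s1; have [_ _ tl] := tailXY.
have := tl (constraint_radius s) (fun z => bump n s (extend_window z))
  (@bump_extend_continuous R d _ n s).
move=> /(_ ltac:(exists 1 => z; rewrite ger0_norm ?bump_ge0 ?bump_le1//)).
under eq_integral do rewrite bump_extend_restrict.
apply: cvg_trans; apply: near_eq_cvg; near=> u.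
have u0 : 0 < u by near: u; exact: nbhs_pinfty_gt.
congr (_ / _)%E; rewrite /mean_bump integral_mkcond; apply: eq_integral => w _.
rewrite patchE; case: ifPn => [_|]; first by rewrite bump_extend_restrict.
move=> /negP uX; rewrite bump_outside// => /s1.
rewrite /rescale normrM normfV (gtr0_norm u0) ltr_pdivlMr// mul1r => uX'.
by apply: uX; rewrite inE.
Unshelve. all: by end_near. Qed.

Lemma mean_bump_shift n s u k : 0 < u ->
  mean_bump n s u = mean_bump n (shift_constraints k s) u.
Proof.
move=> u0.
have mF : measurable_fun [set: config] (fun x => (bump n s (rescale u x))%:E).
  apply/measurable_EFinP; apply: (measurableT_comp (measurable_bump n s)).
  exact: measurable_rescale_cst (ltW u0).
have mkX : measurable_fun [set: TX] (fun w => site_shift k (X w)).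
  exact: (measurableT_comp (measurable_shift k)).
have := @law_integral R d _ _ _ _ PX PX _ _ setT _ mkX mX measurableT _ mF _.
rewrite !preimage_setT => H; rewrite /mean_bump -H.
- by apply: eq_integral => w _; rewrite bump_shift.
- by move=> B mB _; exact: stX.
- by move=> x; rewrite lee_fin bump_ge0.
Qed.

(** By stationarity both sides are limits of the same quotients: the bump
    requires exceedances at 0 and at [k], hence its shift requires one at 0
    too, so that [tail_bump_cvg] applies to both. *)
Lemma exceedance_shift_bump n s k :
  let s1 := exceeds 0%R 1%R :: exceeds k 1%R :: s in
  (\int[P]_w (bump n s1 (Y w))%:E =
   \int[P]_w (bump n s1 (site_shift (- k) (Y w)))%:E)%E.
Proof.
move=> s1.
have H t : forall x : config, positive_on (exceeds 0 1 :: t) x -> 1 < `|x 0|.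
  by move=> x /= /andP[]; rewrite subr_gt0.
have c1 := @tail_bump_cvg n _ (H (exceeds k 1%R :: s)).
pose s2 := exceeds 0%R 1%R :: exceeds (- k)%R 1%R :: shift_constraints (- k) s.
have E x : bump n (shift_constraints (- k) s1) x = bump n s2 x.
  rewrite /s1 /s2 /bump /= !big_cons /= mulrCA; congr (_ * (_ * _)).
    by rewrite subrr.
  by rewrite add0r.
have c2 := @tail_bump_cvg n _ (H (exceeds (- k)%R 1%R :: shift_constraints (- k) s)).
rewrite -/s2 in c2; rewrite -/s1 in c1.
rewrite [RHS](_ : _ = \int[P]_w (bump n s2 (Y w))%:E)%E; last first.
  by apply: eq_integral => w _; rewrite -bump_shift E.
apply: (ereal_lim_near_unique c1 c2); near=> u.
have u0 : 0 < u by near: u; exact: nbhs_pinfty_gt.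
rewrite (mean_bump_shift n s1 (- k) u0); congr (_ / _)%E.
by apply: eq_integral => w _; rewrite E.
Unshelve. all: by end_near. Qed.

(** From bumps to open cylinders by monotone convergence, then to all sets by
    [law_unique]. *)
Lemma exceedance_shift_law k (B : set config) : measurable B ->
  (forall x, B x -> 1 < `|x 0| /\ 1 < `|x k|) ->
  P (Y @^-1` B) = P ((fun w => site_shift (- k) (Y w)) @^-1` B).
Proof.
move=> mB BD.
pose D : set config := positive_on [:: exceeds 0%R 1%R; exceeds k 1%R].
have BDE : B `&` D = B.
  apply/seteqP; split => [x []//|x Bx]; split => //.
  by rewrite /D /positive_on /= !subr_gt0; have [-> ->] := BD _ Bx.
have mkY : measurable_fun [set: T] (fun w => site_shift (- k) (Y w)).
  exact: (measurableT_comp (measurable_shift (- k))).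
rewrite -BDE.
have -> := @law_unique R d _ _ _ _ P P Y _ D 1%:nng mY mkY (measurable_positive_on _) _ B mB.
  by rewrite mul1e.
move=> s /=; rewrite mul1e.
have -> : positive_on s `&` D =
   positive_on [:: exceeds 0%R 1%R, exceeds k 1%R & s].
  rewrite /D !positive_on_cons positive_on_nil setTI.
  by rewrite -setIA; congr (_ `&` _); rewrite setIC.
apply: (ereal_lim_near_unique (@integral_bump_cvg R d _ T P Y _ mY)
  (@integral_bump_cvg R d _ T P _ _ mkY)); apply: nearW => n.
by rewrite exceedance_shift_bump.
Qed.

Variable alpha : R.
Hypothesis indexY : tail_index Y alpha.

(** Changing the threshold from u to u y multiplies the quotients by the ratio
    of P(|X_0| > u y) and P(|X_0| > u). Comparing a bump with the one without
    the constraints [s] eliminates this ratio, whose limit is thus never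
    computed. *)
Lemma scaling_bump n s y : 1 <= y ->
  let s1 t := (0%R, scale_fun y (norm_gt_fun 1)) :: t in
  let s2 t := exceeds 0%R 1%R :: scale_constraints y^-1 t in
  ((\int[P]_w (bump n (s1 s) (Y w))%:E) * (\int[P]_w (bump n (s2 [::]) (Y w))%:E) =
   (\int[P]_w (bump n (s1 [::]) (Y w))%:E) * (\int[P]_w (bump n (s2 s) (Y w))%:E))%E.
Proof.
move=> y1 s1 s2.
have y0 : 0 < y by exact: lt_le_trans y1.
have E t u : 0 < u -> mean_bump n (s1 t) u = mean_bump n (s2 t) (u * y).
  move=> u0; apply: eq_integral => w _; congr EFin.
  rewrite /s1 /s2 /bump !big_cons -!/(bump n _ _) bump_rescale -rescale_rescale.
  congr (_ * _); congr bump.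
  by rewrite rescale_rescale divff ?gt_eqF// rescale1.
have c1 t := @tail_bump_cvg n (s1 t).
have c2 t := @tail_bump_cvg n (s2 t).
have {}c1 t := c1 t ltac:(move=> x /= /andP[+ _]; rewrite subr_gt0 normrM normfV
  (gtr0_norm y0) ltr_pdivlMr// mul1r; exact: le_lt_trans).
have {}c2 t := c2 t ltac:(by move=> x /= /andP[+ _]; rewrite subr_gt0).
have sc : (u * y)%R @[u --> +oo] --> +oo.
  by apply: gt0_cvgMly => //; exact: cvg_id.
have {}c2 t : (mean_bump n (s2 t) (u * y)%R / PX (excX (u * y)%R))%E @[u --> +oo] -->
    (\int[P]_w (bump n (s2 t) (Y w))%:E)%E.
  exact: (cvg_comp _ _ sc (c2 t)).
have fin t : ((\int[P]_w (bump n t (Y w))%:E)%E \is a fin_num).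
  rewrite ge0_fin_numE; last by apply: integral_ge0 => w _; rewrite lee_fin bump_ge0.
  apply: (@le_lt_trans _ _ (\int[P]_w (cst 1 w))%E).
    apply: ge0_le_integral => //.
    - by move=> w _; rewrite lee_fin bump_ge0.
    - apply/measurable_EFinP; exact: (measurableT_comp (measurable_bump n t)).
    - by move=> w _; rewrite lee_fin bump_le1.
  rewrite integral_cst// mul1e.
  exact: (le_lt_trans (probability_le1 P measurableT) (ltry _)).
have L := cvgeM (mule_def_fin (fin _) (fin _)) (c1 s) (c2 [::]).
have Rr := cvgeM (mule_def_fin (fin _) (fin _)) (c1 [::]) (c2 s).
apply: (ereal_lim_near_unique (L _) (Rr _)); near=> u.
have u0 : 0 < u by near: u; exact: nbhs_pinfty_gt.
by rewrite /= !E// muleACA [X in (X * _)%E]muleC muleACA.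
Unshelve. all: by end_near. Qed.

Lemma scaling_law y (B : set config) : 1 <= y -> measurable B ->
  P (Y @^-1` (B `&` (origin_above y))) =
  ((y `^ (- alpha))%:E *
     P ((fun w => rescale y^-1 (Y w)) @^-1` (B `&` (origin_above y))))%E.
Proof.
move=> y1 mB.
have y0 : 0 < y by exact: lt_le_trans y1.
have mD := @measurable_origin_above R d y.
have myY : measurable_fun [set: T] (fun w => rescale y^-1 (Y w)).
  by apply: (measurableT_comp (measurable_rescale_cst _)) => //; rewrite invr_ge0 ltW.
have := @law_unique R d _ _ _ _ P P Y _ _ (NngNum (powR_ge0 y (- alpha))) mY myY mD.
move=> /= /(_ _ B mB); apply => s.
pose s1 t : @constraints R d := (0, scale_fun y (norm_gt_fun 1)) :: t.
pose s2 t : @constraints R d := exceeds 0 1 :: scale_constraints y^-1 t.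
have E1 t : positive_on (s1 t) = positive_on t `&` (origin_above y).
  rewrite /s1 positive_on_cons; congr (_ `&` _); apply/seteqP; split => x /=;
  by rewrite subr_gt0 normrM normfV (gtr0_norm y0) ltr_pdivlMr// mul1r.
have E2 t : Y @^-1` positive_on (s2 t) = (fun w => rescale y^-1 (Y w)) @^-1`
    (positive_on t `&` (origin_above y)).
  have h w : (y < `|rescale y^-1 (Y w) 0|) = (1 < `|Y w 0|).
    by rewrite /rescale invrK normrM (gtr0_norm y0) ltr_pMl.
  apply/seteqP; split => w; rewrite /s2 positive_on_cons /=.
    rewrite positive_on_rescale subr_gt0 => -[Yt radius_gt1]; split => //.
    by rewrite /origin_above /= h.
  rewrite /origin_above /= h positive_on_rescale subr_gt0 => -[Yt radius_gt1]; split => //.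
have lim t := @integral_bump_cvg R d _ T P Y t mY.
have fin t : P (Y @^-1` positive_on t) \is a fin_num.
  by apply: fin_num_measure; exact: measurable_preimage_setT mY (measurable_positive_on _).
have L := cvgeM (mule_def_fin (fin _) (fin _)) (lim (s1 s)) (lim (s2 [::])).
have Rr := cvgeM (mule_def_fin (fin _) (fin _)) (lim (s1 [::])) (lim (s2 s)).
have : (P (Y @^-1` positive_on (s1 s)) * P (Y @^-1` positive_on (s2 [::])) =
        P (Y @^-1` positive_on (s1 [::])) * P (Y @^-1` positive_on (s2 s)))%E.
  apply: (ereal_lim_near_unique (L _) (Rr _)); apply: nearW => n.
  by rewrite /= scaling_bump.
rewrite !E1 -E2 positive_on_nil setTI => H.
have radius_gt1 : P (Y @^-1` positive_on (s2 [::])) = 1%E.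
  have [<- _ _] := tailXY; congr (P _).
  by apply/seteqP; split => w; rewrite /s2 /positive_on /= andbT subr_gt0.
by rewrite -[LHS]mule1 -radius_gt1 H -(indexY y1).
Qed.

(** The direction is invariant under scaling, so [scaling_law] applied to an
    event of directions is the independence of direction and radius. *)
Lemma spectral_radius_independent y (B : set config) : 1 <= y -> measurable B ->
  P (spectral Y @^-1` B `&` (Y @^-1` origin_above y)) =
  (P (spectral Y @^-1` B) * (y `^ (- alpha))%:E)%E.
Proof.
move=> y1 mB.
have y0 : 0 < y by exact: lt_le_trans y1.
pose S (x : config) : config := rescale `|x 0| x.
have mS : measurable_fun [set: config] S.
  apply: measurable_rescale => //; exact: measurable_norm_coord.
have mSB : measurable (S @^-1` B) by exact: measurable_preimage_setT.
have := scaling_law y1 mSB; rewrite -[LHS]/(P (Y @^-1` (S @^-1` B `&` _))) => ->.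
rewrite muleC; congr (_ * _)%E.
have [radius_gt1 _ _] := tailXY.
have mTB : measurable (spectral Y @^-1` B).
  exact: measurable_preimage_setT (measurableT_comp mS mY) mB.
have mY1 : measurable (Y @^-1` origin_above 1).
  exact: measurable_preimage_setT (measurable_origin_above 1).
have -> : (fun w => rescale y^-1 (Y w)) @^-1` (S @^-1` B `&` origin_above y) =
    spectral Y @^-1` B `&` Y @^-1` origin_above 1.
  have h w : S (rescale y^-1 (Y w)) = spectral Y w.
    apply/funext => i; rewrite /S /spectral /rescale !invrK normrM (gtr0_norm y0).
    by rewrite invfM mulrACA divff ?gt_eqF// mulr1.
  have h1 w : origin_above y (rescale y^-1 (Y w)) = origin_above 1 (Y w).
    by rewrite /origin_above /= /rescale invrK normrM (gtr0_norm y0) ltr_pMl.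
  by apply/seteqP; split => w /=; rewrite h h1.
by rewrite probability_setI1.
Qed.

End tail_process_laws.

(** * Identities for the spectral tail process *)

(** With m(t) = min(t,1)^alpha, the quotient m(t) / m(1/t) is t^alpha whether
    t is below or above 1. This is the source of the factor |Theta_k|^alpha in the
    time change formula. *)
Lemma min_powR_ratio {R : realType} (alpha t : R) : 0 < alpha -> 0 <= t ->
  (Num.min t^-1 1 `^ alpha)^-1 * Num.min t 1 `^ alpha = t `^ alpha.
Proof.
move=> alpha0; rewrite le_eqVlt => /predU1P[<-|t0].
  by rewrite (min_l ler01) powR0 ?gt_eqF// mulr0.
have [t1|t1] := leP t 1.
  by rewrite min_r ?invf_ge1// powR1 invr1 mul1r.
rewrite powR1 mulr1 min_l; last by rewrite invf_le1// ltW.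
by rewrite -powRN -(powR_inv1 (ltW t0)) -powRrM mulrNN mul1r.
Qed.

Lemma min_powR_cancel {R : realType} (alpha t : R) : 0 < alpha -> 0 <= t ->
  (Num.min t 1 `^ alpha)^-1 * Num.min t 1 `^ alpha = (0 < t)%R%:R.
Proof.
move=> alpha0; rewrite le_eqVlt => /predU1P[<-|t0].
  by rewrite (min_l ler01) powR0 ?gt_eqF// mulr0 ltxx.
by rewrite t0 mulVf// gt_eqF// powR_gt0// lt_min t0 ltr01.
Qed.

Section spectral_tail_process.
Context {R : realType} {d : nat}.
Notation config := (config R d).
Context {disp : measure_display} {T : measurableType disp}
  (P : probability T R) (Y : {RV P >-> config}) (alpha : R).
(** The properties of the tail process from which the identities follow. *)
Hypothesis alpha0 : 0 < alpha.
Hypothesis radius_gt1 : P (Y @^-1` origin_above 1) = 1%E.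
Hypothesis indexY : tail_index Y alpha.
Hypothesis radius_indep : forall y (B : set config), 1 <= y -> measurable B ->
  P (spectral Y @^-1` B `&` Y @^-1` origin_above y) =
  (P (spectral Y @^-1` B) * (y `^ (- alpha))%:E)%E.
Hypothesis exceedance_shift : forall k (B : set config), measurable B ->
  (forall x, B x -> 1 < `|x 0| /\ 1 < `|x k|) ->
  P (Y @^-1` B) = P ((fun w => site_shift (- k) (Y w)) @^-1` B).

Hypothesis Theta_l0 : P (spectral Y @^-1` @l0 R d) = 1%E.

Let mY : measurable_fun [set: T] Y. Proof. exact: measurable_funP. Qed.

Let mS : measurable_fun [set: T] (spectral Y).
Proof. exact: (measurableT_comp measurable_direction). Qed.

Let radius (w : T) : R := `|Y w 0|.

Let mrad : measurable_fun [set: T] radius.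
Proof. exact: (measurableT_comp (measurable_norm_coord 0)). Qed.

Let mO : measurable (Y @^-1` origin_above 1).
Proof. by apply: measurable_preimage_setT => //; exact: measurable_origin_above. Qed.

(** From half lines to Borel sets of radii by a pi-system argument. Below 1 the
    half lines carry no information because the radius exceeds 1. *)
Lemma spectral_radius_product (A : set config) (B : set R) :
  measurable A -> measurable B ->
  P (spectral Y @^-1` A `&` radius @^-1` B) =
  (P (spectral Y @^-1` A) * P (radius @^-1` B))%E.
Proof.
move=> mA mB.
have mTA : measurable (spectral Y @^-1` A) by exact: measurable_preimage_setT mA.
have [c cE] : exists c : {nonneg R}, P (spectral Y @^-1` A) = c%:num%:E.
  have fA : P (spectral Y @^-1` A) \is a fin_num by exact: fin_num_measure.
  have c0 : 0 <= fine (P (spectral Y @^-1` A)) by rewrite fine_ge0.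
  by exists (NngNum c0); rewrite /= fineK.
pose m1 : {measure set R -> \bar R} :=
  measure_function_pushforward__canonical__measure_function_Measure (mrestr P mTA) mrad.
pose m2 : {measure set R -> \bar R} := mscale c (distribution P (mfun_of mrad)).
have m1E C : m1 C = P (radius @^-1` C `&` spectral Y @^-1` A) by [].
have m2E C : m2 C = (P (spectral Y @^-1` A) * P (radius @^-1` C))%E by rewrite cE.
rewrite setIC -m1E -m2E.
apply: (measure_unique (@RGenOInfty.G R) (fun n => `](- n%:R), +oo[%classic)) => //.
- exact: RGenOInfty.measurableE.
- move=> _ _ [a ->] [b ->]; exists (Num.max a b); apply/seteqP; split => x /=.
    by rewrite !in_itv /= !andbT gt_max => -[-> ->].
  by rewrite !in_itv /= !andbT gt_max => /andP.
- by move=> n; exists (- n%:R).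
- apply/seteqP; split => // x _; exists (Num.truncn `|x|).+1 => //=.
  rewrite in_itv /= andbT ltrNl (le_lt_trans (ler_norm _))// normrN.
  by rewrite truncnS_gt.
- move=> _ [y ->]; rewrite m1E m2E.
  have rE : radius @^-1` `]y, +oo[ = Y @^-1` origin_above y.
    by apply/seteqP; split => w /=; rewrite in_itv /= andbT.
  have [y1|y1] := leP 1 y.
    rewrite setIC rE radius_indep//; congr (_ * _)%E.
    by rewrite -(indexY y1).
  have r1 : P (radius @^-1` `]y, +oo[) = 1%E.
    have mr : measurable (radius @^-1` `]y, +oo[) by exact: measurable_preimage_setT.
    apply/eqP; rewrite eq_le probability_le1//= -[X in (X <= _)%E]radius_gt1.
    apply: le_measure; rewrite ?inE//.
    by rewrite rE => w /=; rewrite /origin_above /=; exact: lt_trans.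
  rewrite r1 mule1 setIC probability_setI1//.
  exact: measurable_preimage_setT.
- move=> n; rewrite m1E (le_lt_trans (probability_le1 P _)) ?ltry//.
  by apply: measurableI => //; exact: measurable_preimage_setT.
Qed.

Lemma radius_tail t : 0 <= t ->
  P [set w | 1 < radius w * t] = (Num.min t 1 `^ alpha)%:E.
Proof.
rewrite le_eqVlt => /predU1P[<-|t0].
  rewrite (_ : [set w | _] = set0) ?measure0.
    by rewrite min_l// powR0// gt_eqF.
  by apply/seteqP; split => w //=; rewrite mulr0 ltr10.
have [t1|t1] := leP t 1.
  rewrite (_ : [set w | _] = [set w | t^-1 < `|Y w 0|]).
    rewrite indexY; last by rewrite invf_ge1.
    by rewrite -(powR_inv1 (ltW t0)) -powRrM mulrNN mul1r.
  by apply/seteqP; split => w /=; rewrite -[t^-1]mul1r ltr_pdivrMr.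
rewrite powR1.
have mt : measurable [set w | 1 < radius w * t].
  apply: measurable_lt_set; first exact: measurable_cst.
  by apply: measurable_funM.
apply/eqP; rewrite eq_le probability_le1//= -[X in (X <= _)%E]radius_gt1.
apply: le_measure; rewrite ?inE//.
move=> w; rewrite /origin_above /= => h; rewrite (lt_trans h)// ltr_pMr//.
exact: lt_trans h.
Qed.

(** |Y_k| is the radius times |Theta_k|; by independence the radius is integrated
    out, which leaves P(|Y_0| t > 1) = min(t,1)^alpha at t = |Theta_k|. *)
Lemma exceedance_given_spectral k (H : config -> \bar R) :
  measurable_fun [set: config] H -> (forall x, 0 <= H x)%E ->
  (\int[P]_w (H (spectral Y w) * (\1_[set w | 1 < radius w * `|spectral Y w k|] w)%:E) =
   \int[P]_w (H (spectral Y w) * (Num.min `|spectral Y w k| 1 `^ alpha)%:E))%E.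
Proof.
move=> mH H0.
pose W w : config * R := (spectral Y w, radius w).
have mW : measurable_fun [set: T] W by apply: measurable_fun_pair.
pose lawS := distribution P (mfun_of mS); pose lawR := distribution P (mfun_of mrad).
pose A : set (config * R) := [set z | 1 < z.2 * `|z.1 k|].
have mA : measurable A.
  apply: measurable_lt_set; first exact: measurable_cst.
  apply: measurable_funM => //.
  exact: (measurableT_comp (measurable_norm_coord k)).
pose F (z : config * R) : \bar R := (H z.1 * (\1_A z)%:E)%E.
have mF : measurable_fun [set: config * R] F.
  apply: emeasurable_funM; first exact: (measurableT_comp mH).
  exact: measurable_EFin_indic.
have F0 z : (0 <= F z)%E by rewrite mule_ge0// lee_fin.
transitivity (\int[P]_w F (W w))%E.
  by apply: eq_integral => w _; rewrite /F /W /= !indicE.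
rewrite -(@ge0_integral_distribution _ _ _ _ R P (mfun_of mW) F)//.
transitivity (\int[lawS \x lawR]_z F z)%E.
  apply: eq_measure_integral => B mB _; apply/esym.
  apply: product_measure_unique => // C D mC mD.
  exact: spectral_radius_product.
rewrite fubini_tonelli1//.
rewrite (eq_integral (fun x : config => H x * (Num.min `|x k| 1 `^ alpha)%:E)%E); last first.
  move=> x _; rewrite /fubini_F /F /=.
  rewrite ge0_integralZl//; last first.
    apply: (measurableT_comp (measurable_EFin_indic mA)); exact: pair1_measurable.
  congr (_ * _)%E; rewrite -radius_tail//.
  rewrite (_ : (fun y => _) = (fun y => (\1_[set y | 1 < y * `|x k|] y)%:E)); last first.
    by apply/funext => y; rewrite !indicE.
  rewrite integral_indic//; last first.
    apply: measurable_lt_set; first exact: measurable_cst.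
    by apply: measurable_funM.
  by rewrite setIT.
rewrite ge0_integral_distribution//.
- apply: emeasurable_funM => //; apply/measurable_EFinP.
  apply: (measurableT_comp (measurable_powR alpha)).
  by apply: measurable_minr => //; exact: measurable_norm_coord.
- by move=> x; rewrite mule_ge0// lee_fin powR_ge0.
Qed.

Let good : set T := spectral Y @^-1` @l0 R d `&` Y @^-1` origin_above 1.

Lemma measurable_good : measurable good.
Proof.
apply: measurableI => //; apply: measurable_preimage_setT => //; exact: measurable_l0.
Qed.

Lemma probability_good : P good = 1%E.
Proof.
rewrite probability_setI1//.
by apply: measurable_preimage_setT => //; exact: measurable_l0.
Qed.

Let mgood := measurable_good.
Let Pgood := probability_good.

Lemma spectral_rescale w : good w -> exists2 c, 0 < c & Y w = rescale c (spectral Y w).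
Proof.
move=> [_ Yw]; have h : 0 < `|Y w 0| by exact: lt_trans Yw.
exists (`|Y w 0|^-1); first by rewrite invr_gt0.
by rewrite /spectral rescale_rescale divff ?gt_eqF// rescale1.
Qed.

Lemma measurable_shifted k : measurable_fun [set: T] (fun w => site_shift k (Y w)).
Proof. exact: (measurableT_comp (measurable_shift k)). Qed.

Lemma exceedance_shift_integral k (F : config -> \bar R) :
  measurable_fun [set: config] F -> (forall x, 0 <= F x)%E ->
  (\int[P]_w (F (Y w) * (\1_[set x : config | exceed x k] (Y w))%:E) =
   \int[P]_w (F (site_shift (- k) (Y w)) *
     (\1_[set x : config | exceed x (- k)%R] (Y w))%:E))%E.
Proof.
move=> mF F0.
pose D : set config := origin_above 1 `&` [set x | exceed x k].
have mD : measurable D.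
  by apply: measurableI; [exact: measurable_origin_above|exact: measurable_exceed].
have := @law_integral R d _ _ T T P P Y _ D F mY (measurable_shifted (- k)) mD _ mF F0.
have h B : measurable B -> B `<=` D ->
    P (Y @^-1` B) = P ((fun w => site_shift (- k) (Y w)) @^-1` B).
  by move=> mB BD; apply: exceedance_shift => // x /BD [].
move=> /(_ h).
have mI l : measurable_fun [set: config] (fun x => (\1_[set x : config | exceed x l] x : R)%:E).
  by apply: measurable_EFin_indic; exact: measurable_exceed.
have E (G : config -> \bar R) (l : site d) (V : T -> config) :
    measurable_fun [set: config] G -> (forall x, 0 <= G x)%E ->
    measurable_fun [set: T] V ->
    (forall w, good w -> D (V w) = exceed (Y w) l) ->
    (\int[P]_(w in V @^-1` D) G (V w) =
     \int[P]_w (G (V w) * (\1_[set x : config | exceed x l] (Y w))%:E))%E.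
  move=> mG G0 mV DV; rewrite integral_mkcond.
  have mVD : measurable (V @^-1` D) by exact: measurable_preimage_setT.
  apply: (eq_integral_full mgood Pgood).
  - apply/(measurable_restrictT _ _).1 => //; apply: measurable_funTS.
    exact: (measurableT_comp mG).
  - apply: emeasurable_funM; first exact: (measurableT_comp mG).
    exact: (measurableT_comp (mI l)).
  - by move=> w; apply: erestrict_ge0.
  - by move=> w; rewrite mule_ge0// lee_fin.
  - move=> w gw; rewrite patchE indicE.
    have [vD|vD] := boolP (w \in V @^-1` D).
      rewrite mem_set ?mule1//=; rewrite inE /= in vD.
      by rewrite -DV.
    rewrite memNset ?mule0//=; move: vD => /negP; rewrite inE /= => vD.
    by rewrite -DV.
rewrite (E F k Y)//; last first.
  move=> w [_ Yw]; apply/propext; split => [[]//|h1]; split => //.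
rewrite (E F (- k) (fun w => site_shift (- k) (Y w)))//.
  exact: measurable_shifted.
move=> w [_ Yw]; rewrite /D /origin_above /exceed /= /site_shift add0r subrr.
by apply/propext; split => [[]//|h1]; split.
Qed.

Lemma good_spectral0 w : good w -> `|spectral Y w 0| = 1.
Proof.
move=> [_]; rewrite /origin_above /= => Yw.
have h : 0 < `|Y w 0| by exact: lt_trans Yw.
by rewrite /spectral /rescale normrM normfV normr_id divff// gt_eqF.
Qed.

(** For a function of the direction, [exceedance_shift_integral] and
    [exceedance_given_spectral] give, with m(t) = min(t,1)^alpha,
    E[H(recenter k Theta) m(|Theta_k|)] = E[H(Theta) m(|Theta_{-k}|)].
    Weighting [H] by the inverse of m(|x_{-k}|) cancels m on the right, and on
    the left, where the coordinate -k of recenter k Theta has modulus 1/|Theta_k|,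
    leaves |Theta_k|^alpha by [min_powR_ratio]. *)
Lemma time_change k (H : config -> \bar R) :
  measurable_fun [set: config] H -> (forall x, 0 <= H x)%E ->
  (\int[P]_w (H (recenter k (spectral Y w)) * (`|spectral Y w k| `^ alpha)%:E) =
   \int[P]_w (H (spectral Y w) * (\1_[set x : config | 0%R < `|x (- k)%R| ] (spectral Y w))%:E))%E.
Proof.
move=> mH H0.
pose m (t : R) := Num.min t 1 `^ alpha.
have mm l : measurable_fun [set: config] (fun x : config => m `|x l|).
  apply: (measurableT_comp (measurable_powR alpha)).
  by apply: measurable_minr => //; exact: measurable_norm_coord.
have m0 t : 0 <= m t by exact: powR_ge0.
(* the inverse is 0 where the coordinate -k vanishes: this produces the
   indicator on the right-hand side *)
pose H' (x : config) : \bar R := (H x * ((m `|x (- k)|)^-1)%:E)%E.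
have mH' : measurable_fun [set: config] H'.
  apply: emeasurable_funM => //; apply/measurable_EFinP.
  exact: (measurable_fun_inv_ge0 (fun x => m0 _) (mm (- k))).
have H'0 x : (0 <= H' x)%E by rewrite mule_ge0// lee_fin invr_ge0.
have mrS l : measurable_fun [set: T] (fun w => recenter l (spectral Y w)).
  exact: (measurableT_comp (measurable_recenter l)).
have mind l : measurable_fun [set: T]
    (fun w => (\1_[set w | 1 < `|Y w 0| * `|spectral Y w l|] w : R)%:E).
  apply: measurable_EFin_indic; apply: measurable_lt_set; first exact: measurable_cst.
  apply: measurable_funM; first exact: (measurableT_comp (measurable_norm_coord 0)).
  exact: (measurableT_comp (measurable_norm_coord l)).
have mexc l : measurable_fun [set: T]
    (fun w => (\1_[set x : config | exceed x l] (Y w) : R)%:E).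
  apply: (measurableT_comp (f := fun x : config =>
    (\1_[set x : config | exceed x l] x : R)%:E)) => //.
  by apply: measurable_EFin_indic; exact: measurable_exceed.
have indE w l : good w ->
    (\1_[set x : config | exceed x l] (Y w) : R) =
    \1_[set w | 1 < `|Y w 0| * `|spectral Y w l|] w.
  move=> gw; rewrite !indicE; congr ((_ : bool)%:R).
  have h : 0 < `|Y w 0| by case: gw => _ Yw; exact: lt_trans Yw.
  apply/idP/idP; rewrite !inE /exceed /= /spectral /rescale normrM normfV normr_id;
  by rewrite mulrC divfK// gt_eqF.
have step1 : (\int[P]_w (H' (recenter k (spectral Y w)) * (m `|spectral Y w k|)%:E) =
    \int[P]_w (H' (spectral Y w) * (m `|spectral Y w (- k)%R|)%:E))%E.
  rewrite -(@exceedance_given_spectral k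
    (fun x => H' (recenter k x)))//; last exact: (measurableT_comp mH' (measurable_recenter k)).
  rewrite -(@exceedance_given_spectral (- k) H')//.
  have := @exceedance_shift_integral k (fun x => H' (recenter k x))
    (measurableT_comp mH' (measurable_recenter k)) (fun x => H'0 _).
  have -> : (\int[P]_w (H' (recenter k (Y w)) * (\1_[set x : config | exceed x k] (Y w))%:E) =
     \int[P]_w (H' (recenter k (spectral Y w)) *
        (\1_[set w | (1 < `|Y w 0| * `|spectral Y w k|)%R] w)%:E))%E.
    apply: (eq_integral_full mgood Pgood).
    - apply: emeasurable_funM; last exact: mexc.
      exact: (measurableT_comp mH' (measurableT_comp (measurable_recenter k) mY)).
    - by apply: emeasurable_funM => //; exact: (measurableT_comp mH').
    - by move=> w; rewrite mule_ge0// lee_fin.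
    - by move=> w; rewrite mule_ge0// lee_fin.
    - move=> w gw; rewrite indE//; have [c c0 ->] := spectral_rescale gw.
      by rewrite recenter_rescale.
  move=> ->.
  apply: (eq_integral_full mgood Pgood).
  - apply: emeasurable_funM; last exact: mexc.
    exact: (measurableT_comp mH'
      (measurableT_comp (measurable_recenter k) (measurable_shifted (- k)))).
  - by apply: emeasurable_funM => //; exact: (measurableT_comp mH').
  - by move=> w; rewrite mule_ge0// lee_fin.
  - by move=> w; rewrite mule_ge0// lee_fin.
  - move=> w gw; rewrite indE//; congr (_ * _)%E; congr H'.
    by rewrite /recenter shift_shift addrN shift0.
transitivity (\int[P]_w (H' (recenter k (spectral Y w)) * (m `|spectral Y w k|)%:E))%E.
  apply: (eq_integral_full mgood Pgood).
  - apply: emeasurable_funM; first exact: (measurableT_comp mH).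
    exact: (measurableT_comp (measurable_norm_coord_powR alpha k)).
  - apply: emeasurable_funM; first exact: (measurableT_comp mH').
    by apply/measurable_EFinP; exact: (measurableT_comp (mm k)).
  - by move=> w; rewrite mule_ge0// lee_fin powR_ge0.
  - by move=> w; apply: mule_ge0; [exact: H'0|rewrite lee_fin; exact: m0].
  - move=> w gw; rewrite /H' -muleA -EFinM; congr (_ * _%:E)%E.
    set t := `|spectral Y w k|.
    have -> : `|recenter k (spectral Y w) (- k)| = t^-1.
      rewrite recenterE /rescale shiftE addNr normrM normfV normr_id.
      by rewrite (good_spectral0 gw) mul1r.
    exact/esym/(min_powR_ratio alpha0 (normr_ge0 _)).
rewrite step1; apply: eq_integral => w _; rewrite /H' -muleA -EFinM; congr (_ * _%:E)%E.
rewrite indicE /m (min_powR_cancel alpha0 (normr_ge0 _)).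
by congr ((_ : bool)%:R); apply/idP/idP; rewrite !inE.
Qed.

Lemma good_spectral_neq0 w : good w -> spectral Y w 0 != 0.
Proof. by move=> /good_spectral0 h; rewrite -normr_eq0 h oner_neq0. Qed.

Lemma good_firstmax w : good w -> exists k, firstmax (spectral Y w) k.
Proof. by move=> gw; apply: firstmax_exists_l0 (good_spectral_neq0 gw); case: gw. Qed.

Lemma good_E0 w : good w -> E0 (Y w).
Proof.
move=> [Sl Yw]; split; first exact: Yw.
apply: l0_finite_exceed.
have h : 0 < `|Y w 0| by exact: lt_trans Yw.
have -> : Y w = rescale `|Y w 0|^-1 (spectral Y w).
  by rewrite /spectral rescale_rescale divff ?gt_eqF// rescale1.
exact: l0_rescale.
Qed.

(** Almost surely Theta has exactly one first maximum, at -k say. The time change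
    formula moves it to the origin, where recentering no longer affects the
    event that the maximum is there. *)
Lemma spectral_decomposition (H : config -> \bar R) :
  measurable_fun [set: config] H -> (forall x, 0 <= H x)%E ->
  (\int[P]_w H (spectral Y w) =
   \int[P]_w ((\1_max_at_origin (spectral Y w))%:E *
     \esum_(k in [set: site d])
       (H (recenter k (spectral Y w)) * (`|spectral Y w k| `^ alpha)%:E)))%E.
Proof.
move=> mH H0.
(* the contribution of the configurations with first maximum at -k *)
pose Hk k (x : config) : \bar R :=
  (H x * (\1_max_at_origin (site_shift (- k) x))%:E)%E.
have mHk k : measurable_fun [set: config] (Hk k).
  apply: emeasurable_funM => //.
  apply: (measurableT_comp (f := fun x => (\1_max_at_origin x : R)%:E)).
    by apply: measurable_EFin_indic; exact: measurable_max_at_origin.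
  exact: measurable_shift.
have Hk0 k x : (0 <= Hk k x)%E by apply: mule_ge0 => //; rewrite lee_fin.
have mHkS k : measurable_fun [set: T] (fun w => Hk k (spectral Y w)).
  exact: (measurableT_comp (mHk k)).
have mt k : measurable_fun [set: T] (fun w =>
    (H (recenter k (spectral Y w)) * (`|spectral Y w k| `^ alpha)%:E)%E).
  apply: emeasurable_funM.
    exact: (measurableT_comp mH (measurableT_comp (measurable_recenter k) mS)).
  exact: (measurableT_comp (measurable_norm_coord_powR alpha k)).
have t0 k w : (0 <= H (recenter k (spectral Y w)) * (`|spectral Y w k| `^ alpha)%:E)%E.
  by apply: mule_ge0 => //; rewrite lee_fin powR_ge0.
have m1 : measurable_fun [set: T] (fun w => (\1_max_at_origin (spectral Y w) : R)%:E).
  apply: (measurableT_comp (f := fun x => (\1_max_at_origin x : R)%:E)) => //.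
  by apply: measurable_EFin_indic; exact: measurable_max_at_origin.
transitivity (\int[P]_w (\esum_(k in [set: site d]) Hk k (spectral Y w)))%E.
  apply: (eq_integral_full mgood Pgood) => //.
  - exact: (measurableT_comp mH).
  - exact: measurable_fun_esum.
  - by move=> w; exact: esum_ge0.
  - move=> w gw; have [j xj] := good_firstmax gw.
    rewrite (@esum_delta _ _ _ (- j)) => //.
      rewrite /Hk opprK indicE mem_set ?mule1//.
      by rewrite max_at_origin_shift.
    move=> k kj; rewrite /Hk indicE memNset ?mule0//.
    rewrite max_at_origin_shift => xk.
    by move: kj; rewrite -(firstmax_unique xk xj) opprK eqxx.
rewrite integral_esum//.
transitivity (\esum_(k in [set: site d]) \int[P]_w
   ((\1_max_at_origin (spectral Y w))%:E * (H (recenter k (spectral Y w)) *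
     (`|spectral Y w k| `^ alpha)%:E)))%E; last first.
  rewrite -integral_esum//.
  - by apply: eq_integral => w _; rewrite ge0_esumZl.
  - by move=> k; exact: emeasurable_funM.
  - by move=> k w; apply: mule_ge0 => //; rewrite lee_fin.
apply: eq_esum => k _.
transitivity (\int[P]_w (Hk k (spectral Y w) *
    (\1_[set x : config | 0%R < `|x (- k)%R| ] (spectral Y w))%:E))%E.
  apply: (eq_integral_full mgood Pgood) => //.
  - apply: emeasurable_funM => //.
    apply: (measurableT_comp (f := fun x => (\1_[set x : config | 0%R < `|x (- k)%R| ] x : R)%:E)) => //.
    apply: measurable_EFin_indic; apply: measurable_lt_set; first exact: measurable_cst.
    exact: measurable_norm_coord.
  - by move=> w; apply: mule_ge0 => //; rewrite lee_fin.
  - move=> w gw; rewrite /Hk; have [xk|xk] := pselect (firstmax (spectral Y w) (- k)).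
      rewrite [X in (_ = _ * X%:E)%E]indicE mem_set ?mule1//=.
      exact: (firstmax_neq0 (good_spectral_neq0 gw)).
    rewrite (_ : \1_max_at_origin _ = 0) ?mule0 ?mul0e// indicE memNset//.
    by rewrite max_at_origin_shift.
rewrite -(time_change)//.
apply: eq_integral => w _; rewrite /Hk [RHS]muleCA.
rewrite -muleA; congr (_ * _)%E.
have [->|xk] := eqVneq (spectral Y w k) 0.
  by rewrite normr0 powR0 ?gt_eqF// !mule0.
congr (_%:E * _)%E; rewrite recenterE shift_rescale shift_shift addNr shift0.
rewrite !indicE; congr ((_ : bool)%:R).
by apply/idP/idP; rewrite !inE /max_at_origin /= firstmax_rescale ?normr_gt0.
Qed.

(** Split 1/|e(Y)| according to the anchor k of Y, which is an exceedance. Under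
    the shift by -k, configurations with anchor k become those with anchor 0
    and an exceedance at -k. Summing over k counts all exceedances of Y, which
    cancels the factor 1/|e(Y)|. *)
Lemma anchor_invariance (A : config -> site d) (F : config -> \bar R) :
  anchoring A -> measurable_fun [set: config] F -> (forall x, 0 <= F x)%E ->
  (forall x k, F (site_shift k x) = F x) ->
  (\int[P]_w (F (Y w) * (\1_[set x : config | E0 x /\ A x = 0%R] (Y w))%:E) =
   \int[P]_w (F (Y w) * (inv_card_exceed (Y w))%:E))%E.
Proof.
move=> [mA Aexc Ashift] mF F0 Fshift.
pose E k : set config := [set x | E0 x /\ A x = k].
have mE k : measurable (E k).
  by have := mA [set k]; rewrite (_ : _ `&` _ = E k).
have mind (B : set config) : measurable B ->
    measurable_fun [set: config] (fun x => (\1_B x : R)%:E).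
  exact: measurable_EFin_indic.
(* the contribution of the configurations anchored at k *)
pose G k x : \bar R := (F x * (inv_card_exceed x)%:E * (\1_(E k) x)%:E)%E.
have mFi : measurable_fun [set: config] (fun x => (F x * (inv_card_exceed x)%:E)%E).
  apply: emeasurable_funM => //; apply/measurable_EFinP.
  exact: measurable_inv_card_exceed.
have Fi0 x : (0 <= F x * (inv_card_exceed x)%:E)%E.
  by apply: mule_ge0 => //; rewrite lee_fin inv_card_exceed_ge0.
have mG k : measurable_fun [set: config] (G k).
  by apply: emeasurable_funM => //; exact: mind.
have G0 k x : (0 <= G k x)%E by apply: mule_ge0 => //; rewrite lee_fin.
pose e k : set config := [set x | exceed x k].
have me k : measurable (e k) by exact: measurable_exceed.
apply/esym.
transitivity (\int[P]_w (\esum_(k in [set: site d]) (G k (Y w) * (\1_(e k) (Y w))%:E)))%E.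
  apply: (eq_integral_full mgood Pgood) => //.
  - exact: (measurableT_comp mFi).
  - apply: measurable_fun_esum => [k|k w]; last by apply: mule_ge0 => //; rewrite lee_fin.
    apply: emeasurable_funM; first exact: (measurableT_comp (mG k)).
    exact: (measurableT_comp (mind _ (me k))).
  - by move=> w; apply: esum_ge0 => k _; apply: mule_ge0 => //; rewrite lee_fin.
  - move=> w /good_E0 Yw.
    rewrite (@esum_delta _ _ _ (A (Y w))).
    + rewrite /G !indicE mem_set//= mem_set ?mule1//; exact: Aexc.
    + by move=> k; apply: mule_ge0 => //; rewrite lee_fin.
    + move=> k kA; rewrite /G (_ : \1_(E k) _ = 0) ?mule0 ?mul0e// indicE memNset//.
      by move=> [_ Ak]; move: kA; rewrite Ak eqxx.
rewrite integral_esum; last 2 first.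
- move=> k; apply: emeasurable_funM; first exact: (measurableT_comp (mG k)).
  exact: (measurableT_comp (mind _ (me k))).
- by move=> k w; apply: mule_ge0 => //; rewrite lee_fin.
transitivity (\esum_(k in [set: site d]) \int[P]_w
    (G 0%R (Y w) * (\1_(e (- k)%R) (Y w))%:E))%E.
  apply: eq_esum => k _.
  rewrite (exceedance_shift_integral k (mG k) (G0 k)).
  apply: (eq_integral_full mgood Pgood) => //.
  - apply: emeasurable_funM; last exact: (measurableT_comp (mind _ (me _))).
    exact: (measurableT_comp (mG k) (measurable_shifted (- k))).
  - apply: emeasurable_funM; last exact: (measurableT_comp (mind _ (me _))).
    exact: (measurableT_comp (mG 0%R)).
  - by move=> w; apply: mule_ge0 => //; rewrite lee_fin.
  - by move=> w; apply: mule_ge0 => //; rewrite lee_fin.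
  - move=> w /good_E0 Yw; rewrite /e.
    have [ek|ek] := pselect (exceed (Y w) (- k)); last first.
      by rewrite (_ : \1__ _ = 0) ?mule0// indicE memNset.
    congr (_ * _)%E; rewrite /G Fshift inv_card_exceed_shift; congr (_ * _%:E)%E.
    rewrite !indicE; congr ((_ : bool)%:R).
    have Es : E0 (site_shift (- k) (Y w)).
      split; first by rewrite shiftE add0r.
      by rewrite -/(finite_set _) finite_exceed_shift; case: Yw.
    have Ak := Ashift _ Yw _ ek.
    apply/idP/idP; rewrite !inE /E /=.
      by move=> [_ h]; split => //; rewrite -Ak h subrr.
    move=> [_ h]; split => //.
    by apply: (addIr (- k)); rewrite subrr Ak.
rewrite -integral_esum; last 2 first.
- move=> k; apply: emeasurable_funM; first exact: (measurableT_comp (mG 0%R)).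
  exact: (measurableT_comp (mind _ (me _))).
- by move=> k w; apply: mule_ge0 => //; rewrite lee_fin.
apply: (eq_integral_full mgood Pgood) => //.
- apply: measurable_fun_esum => [k|k w]; last by apply: mule_ge0 => //; rewrite lee_fin.
  apply: emeasurable_funM; first exact: (measurableT_comp (mG 0%R)).
  exact: (measurableT_comp (mind _ (me _))).
- apply: emeasurable_funM; first exact: (measurableT_comp mF).
  exact: (measurableT_comp (mind _ (mE 0%R))).
- by move=> w; apply: esum_ge0 => k _; apply: mule_ge0 => //; rewrite lee_fin.
- by move=> w; apply: mule_ge0 => //; rewrite lee_fin.
- move=> w /good_E0 Yw.
  rewrite ge0_esumZl//.
  have -> : (\esum_(k in [set: site d]) (\1_(e (- k)%R) (Y w))%:E = num_exceed (Y w))%E.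
    have bij : set_bij [set: site d] [set: site d] (fun k => - k).
      split; [by []|by move=> i j _ _; exact: oppr_inj|].
      by move=> k _; exists (- k)%R => //; rewrite opprK.
    apply/esym; have := @reindex_esum R _ _ _ _ _ (fun k => (\1_(e k) (Y w))%:E) bij.
    exact.
  case: (Yw) => Y0 fY.
  by rewrite /G muleAC -[(_ * num_exceed _)%E]muleA (inv_card_exceedK fY Y0) mule1.
Qed.

Definition mean_at_max (F : config -> \bar R) : \bar R :=
  (\int[P]_w ((\1_max_at_origin (spectral Y w))%:E * F (spectral Y w)))%E.

Let mDS : measurable_fun [set: T] (fun w => (\1_max_at_origin (spectral Y w) : R)%:E).
Proof.
apply: (measurableT_comp (f := fun x => (\1_max_at_origin x : R)%:E)) => //.
by apply: measurable_EFin_indic; exact: measurable_max_at_origin.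
Qed.

Let mJ (F : config -> \bar R) : measurable_fun [set: config] F ->
  measurable_fun [set: T] (fun w => ((\1_max_at_origin (spectral Y w) : R)%:E * F (spectral Y w))%E).
Proof. by move=> mF; apply: emeasurable_funM => //; exact: (measurableT_comp mF). Qed.

(** The first maximum is an anchor for which the anchoring event depends on the
    direction of Y only. *)
Lemma inv_card_mean (F : config -> \bar R) :
  measurable_fun [set: config] F -> (forall x, 0 <= F x)%E ->
  (forall x k, F (site_shift k x) = F x) ->
  (forall w, good w -> F (Y w) = F (spectral Y w)) ->
  (\int[P]_w (F (Y w) * (inv_card_exceed (Y w))%:E) = mean_at_max F)%E.
Proof.
move=> mF F0 Fs FS.
rewrite -(anchor_invariance anchoring_first_maximizer)//.
have mE : measurable [set x : config | E0 x /\ first_maximizer x = 0%R].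
  have [mA _ _] := @anchoring_first_maximizer R d.
  by have := mA [set 0%R]; rewrite (_ : _ `&` _ = [set x : config | E0 x /\ first_maximizer x = 0%R]).
apply: (eq_integral_full mgood Pgood).
- apply: emeasurable_funM; first exact: (measurableT_comp mF).
  exact: (measurableT_comp (measurable_EFin_indic mE)).
- exact: mJ.
- by move=> w; apply: mule_ge0 => //; rewrite lee_fin.
- by move=> w; apply: mule_ge0 => //; rewrite lee_fin.
- move=> w gw; rewrite muleC FS//; congr (_%:E * _)%E.
  rewrite !indicE; congr ((_ : bool)%:R).
  have Yw := good_E0 gw; have [k xk _] := firstmax_exists_E0 Yw.
  have [c c0 Yc] := spectral_rescale gw.
  have xk' : firstmax (spectral Y w) k by move: xk; rewrite {1}Yc firstmax_rescale.
  apply/idP/idP; rewrite !inE /max_at_origin /=.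
    by rewrite (first_maximizerE xk) => -[_ <-].
  by move=> x0; split => //; rewrite (first_maximizerE xk); exact: firstmax_unique xk' x0.
Qed.

Lemma mean_at_max1 : mean_at_max (fun=> 1%E) = P (spectral Y @^-1` max_at_origin).
Proof.
rewrite -integral_EFin_indic; last first.
  by apply: measurable_preimage_setT => //; exact: measurable_max_at_origin.
by apply: eq_integral => w _; rewrite mule1 !indicE.
Qed.

Lemma vartheta_max : vartheta Y = P (spectral Y @^-1` max_at_origin).
Proof.
rewrite -mean_at_max1 -inv_card_mean//.
by rewrite /vartheta unlock; apply: eq_integral => w _; rewrite mul1e.
Qed.

(** The decomposition of the constant function 1. In particular the sum of the
    powers is finite on D. *)
Lemma mean_at_max_sum_power : mean_at_max (sum_power alpha) = 1%E.
Proof.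
have E1 : (\int[P]_w (cst 1 w) = 1 :> \bar R)%E.
  by rewrite integral_cst// mul1e; exact: probability_setT.
have := @spectral_decomposition
  (fun=> 1%E) (measurable_cst _) (fun=> lee01).
rewrite [LHS]E1 => ->.
apply: eq_integral => w _; congr (_ * _)%E.
by apply: eq_esum => k _; rewrite mul1e.
Qed.

(** If the set D of configurations with first maximum at the origin
    had probability 0, [mean_at_max_sum_power] would read 0 = 1. *)
Lemma vartheta_gt0 : (0 < vartheta Y)%E.
Proof.
rewrite vartheta_max lt_neqAle measure_ge0 andbT; apply/negP => /eqP v0.
have mD : measurable (spectral Y @^-1` max_at_origin).
  by apply: measurable_preimage_setT => //; exact: measurable_max_at_origin.
have : mean_at_max (sum_power alpha) = (\int[P]_w cst 0 w)%E.
  apply: (@eq_integral_full _ _ _ P (~` (spectral Y @^-1` max_at_origin))) => //.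
  - exact: measurableC.
  - by have h := probability_setC P mD; rewrite h -v0 sube0.
  - exact: (mJ (measurable_sum_power alpha)).
  - by move=> w; rewrite mule_ge0// ?lee_fin// sum_power_ge0.
  - by move=> w /= nD; rewrite indicE memNset// mul0e.
rewrite mean_at_max_sum_power integral0 => /eqP.
by rewrite gt_eqF// lte01.
Qed.

Lemma vartheta_fin : vartheta Y \is a fin_num.
Proof.
rewrite vartheta_max; apply: fin_num_measure.
by apply: measurable_preimage_setT => //; exact: measurable_max_at_origin.
Qed.

Lemma sum_power_finite_at_max : exists N, [/\ measurable N, P N = 1%E &
  forall w, N w -> max_at_origin (spectral Y w) -> (sum_power alpha (spectral Y w) < +oo)%E].
Proof.
have S0 w : (0 <= (\1_max_at_origin (spectral Y w))%:E * sum_power alpha (spectral Y w))%E.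
  by rewrite mule_ge0// ?lee_fin// sum_power_ge0.
have Soo : (mean_at_max (sum_power alpha) < +oo)%E by rewrite mean_at_max_sum_power ltry.
have [N [mN N1 Nfin]] := full_lty (mJ (measurable_sum_power alpha)) S0 Soo.
exists N; split => // w /Nfin + xD.
by rewrite indicE mem_set// mul1e.
Qed.

(** On D the supremum norm of Theta is 1 and normalization is the identity, so
    [esum_spectral_ratio] reduces the decomposition to the mean of [h]. *)
Lemma mean_spectral_ratio h : l0_nneg_measurable h -> shift_invariant h ->
  expect_l0 P (spectral Y) (fun x => (spectral_ratio alpha h x)%:E) =
  mean_at_max (fun x => (zero_ext h x)%:E).
Proof.
move=> mh hs; rewrite expect_l0_zero_ext.
have mg := spectral_ratio_l0_nneg_measurable alpha mh.
have mzg := measurable_zero_ext mg.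
rewrite (@spectral_decomposition
  (fun x => (zero_ext (spectral_ratio alpha h) x)%:E))//; last 2 first.
- exact/measurable_EFinP.
- by move=> x; rewrite lee_fin zero_ext_ge0.
have [N [mN N1 Nfin]] := sum_power_finite_at_max.
apply: (@eq_integral_full _ _ _ P (good `&` N)) => //.
- exact: measurableI.
- by rewrite probability_setI1.
- apply: (mJ (F := fun x => \esum_(k in [set: site d])
     ((zero_ext (spectral_ratio alpha h) (recenter k x))%:E * (`|x k| `^ alpha)%:E)))%E.
  apply: measurable_fun_esum => [k|k x]; last first.
    by rewrite mule_ge0// lee_fin ?powR_ge0// zero_ext_ge0.
  apply: emeasurable_funM; last exact: measurable_norm_coord_powR.
  by apply/measurable_EFinP; exact: (measurableT_comp mzg (measurable_recenter k)).
- apply: (mJ (F := fun x => (zero_ext h x)%:E)); apply/measurable_EFinP.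
  exact: measurable_zero_ext.
- move=> w; rewrite mule_ge0// ?lee_fin//; apply: esum_ge0 => k _.
  by rewrite mule_ge0// lee_fin ?powR_ge0// zero_ext_ge0.
- by move=> w; rewrite mule_ge0// lee_fin// zero_ext_ge0.
- move=> w [gw Nw]; have [xD|xD] := pselect (max_at_origin (spectral Y w)); last first.
    by rewrite indicE memNset// !mul0e.
  congr (_ * _)%E.
  have [Sl _] := gw; have S0 := good_spectral_neq0 gw.
  rewrite (esum_spectral_ratio alpha0 Sl hs mh xD S0 (Nfin _ Nw xD)).
  have sup1 : supnorm (spectral Y w) = 1 by rewrite (supnorm_firstmax xD) good_spectral0.
  by rewrite zero_extE// /normalize sup1 rescale1 powR1 mulr1.
Qed.

Definition anchor_event (A : config -> site d) : set config :=
  [set x | E0 x /\ A x = 0].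

Lemma measurable_anchor_event A : anchoring A -> measurable (anchor_event A).
Proof.
by move=> [mA _ _]; have := mA [set 0]; rewrite (_ : _ `&` _ = anchor_event A).
Qed.

Lemma probability_anchor_event A : anchoring A ->
  P (Y @^-1` anchor_event A) = vartheta Y.
Proof.
move=> anA; have mE := measurable_anchor_event anA.
have mYE : measurable (Y @^-1` anchor_event A) by exact: measurable_preimage_setT.
rewrite -integral_EFin_indic//.
have := anchor_invariance anA (measurable_cst (1 : \bar R)%E)
  (fun=> lee01) (fun _ _ => erefl).
rewrite /vartheta unlock => H.
transitivity (\int[P]_w (cst 1 (Y w) * (\1_(anchor_event A) (Y w))%:E))%E.
  by apply: eq_integral => w _; rewrite mul1e !indicE.
by rewrite H; apply: eq_integral => w _; rewrite mul1e.
Qed.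

Lemma vartheta_real : exists2 r : R, 0 < r & vartheta Y = r%:E.
Proof.
have v0 := vartheta_gt0.
have vf := vartheta_fin.
by exists (fine (vartheta Y)); rewrite ?fineK// -lte_fin fineK.
Qed.

(** Conditioning on the anchoring event is division by its probability, which is
    vartheta; [inv_card_mean] then removes the dependence on the anchor. *)
Lemma anchored_mean A {dispZ : measure_display} {TZ : measurableType dispZ}
    (PZ : probability TZ R) (Z : {RV PZ >-> config}) (F : config -> \bar R) :
  anchoring A -> anchored_process Y A Z ->
  measurable_fun [set: config] F -> (forall x, 0 <= F x)%E ->
  (forall x k, F (site_shift k x) = F x) ->
  (forall w, good w -> F (Y w) = F (spectral Y w)) ->
  (\int[PZ]_w F (Z w) = (vartheta Y)^-1 * mean_at_max F)%E.
Proof.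
move=> anA [_ lawZ] mF F0 Fs FS; have mE := measurable_anchor_event anA.
have [r r0 vr] := vartheta_real.
have rV0 : 0 <= r^-1 by rewrite invr_ge0 ltW.
have mZ : measurable_fun [set: TZ] Z by exact: measurable_funP.
have lawE B : measurable B -> B `<=` anchor_event A ->
    PZ (Z @^-1` B) = (r^-1%:E * P (Y @^-1` B))%E.
  move=> mB BE; have := lawZ B mB.
  rewrite (_ : [set w | E0 (Y w) /\ A (Y w) = 0] = Y @^-1` anchor_event A)//.
  rewrite probability_anchor_event// vr inver gt_eqF// muleC.
  rewrite (_ : [set w | [/\ _, _ & _]] = Y @^-1` B)//.
  apply/seteqP; split => w /=; first by case.
  by move=> Bw; have [] := BE _ Bw.
have lawE1 : distribution PZ Z (~` anchor_event A) = 0%E.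
  have h : PZ (Z @^-1` anchor_event A) = 1%E.
    by rewrite lawE// probability_anchor_event// vr -EFinM mulVf// gt_eqF.
  have := probability_setC PZ (measurable_preimage_setT mZ mE).
  by rewrite h subee.
rewrite -(@ge0_integral_distribution _ _ _ _ R PZ Z F)//.
rewrite (@ge0_negligible_integral _ _ _ _ _ (~` anchor_event A))//; last exact: measurableC.
rewrite setDE setCK setTI.
rewrite (@eq_measure_integral _ _ _ _ (mscale (NngNum rV0) (distribution P Y)))/=; last first.
  by move=> B mB BE; exact: lawE.
rewrite ge0_integral_mscale//; last exact: measurable_funTS.
rewrite /= vr inver gt_eqF//; congr (_ * _)%E.
rewrite ge0_integral_pushforward//; last exact: measurable_funTS.
rewrite -(inv_card_mean)//.
rewrite -(anchor_invariance anA)//.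
rewrite integral_mkcond; apply: eq_integral => w _; rewrite patchE indicE.
have -> : (w \in Y @^-1` anchor_event A) = (Y w \in anchor_event A).
  by apply/idP/idP; rewrite !inE.
by case: (Y w \in anchor_event A); rewrite ?mule1 ?mule0.
Qed.

(** The probability space of Y is conditioned on the anchoring event; outside
    that event [Z] is set to a fixed element of [E0]. *)
Lemma exists_anchored_process A : anchoring A ->
  exists (dispZ : measure_display) (TZ : measurableType dispZ)
    (PZ : probability TZ R) (Z : {RV PZ >-> config}), anchored_process Y A Z.
Proof.
move=> anA; have mE := measurable_anchor_event anA.
have [r r0 vr] := vartheta_real.
have mYE : measurable (Y @^-1` anchor_event A) by exact: measurable_preimage_setT.
(* an arbitrary element of E0 *)
pose x0 : config := fun i => if i == 0 then 2 else 0.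
have x0E : E0 x0.
  split; first by rewrite /x0 eqxx ger0_norm// ltr1n.
  apply: (@sub_finite_set _ _ [set 0]); last exact: finite_set1.
  by move=> i; rewrite /exceed /x0 /=; case: eqVneq => // _; rewrite normr0 ltr10.
pose Z w : config := if w \in Y @^-1` anchor_event A then Y w else x0.
have mZ : measurable_fun [set: T] Z.
  apply: measurable_fun_ifT => //.
  apply: (measurable_fun_bool true); rewrite setTI.
  rewrite (_ : _ @^-1` _ = Y @^-1` anchor_event A)//.
  by apply/seteqP; split => w /=; [move=> /set_mem|move=> /mem_set].
pose PZ : probability T R := mnormalize (mrestr P mYE) P.
exists disp, T, PZ, (mfun_of mZ); split.
  move=> w; rewrite /= /Z; case: ifPn => //; rewrite inE => -[//].
move=> B mB.
have PT : (mrestr P mYE : {measure set T -> \bar R}) setT = r%:E.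
  by rewrite /= /mrestr setTI probability_anchor_event.
rewrite (_ : [set w | E0 (Y w) /\ A (Y w) = 0] = Y @^-1` anchor_event A)//.
rewrite probability_anchor_event// vr inver gt_eqF//.
have PZE C : PZ C = (P (C `&` Y @^-1` anchor_event A) * r^-1%:E)%E.
  change (mnormalize (mrestr P mYE) P C = (P (C `&` Y @^-1` anchor_event A) * r^-1%:E)%E).
  by rewrite /mnormalize PT eqe gt_eqF.
rewrite PZE; congr (P _ * _)%E.
apply/seteqP; split => w /=.
  by move=> [+ Yw]; rewrite /Z mem_set//; case: Yw.
by move=> [Bw Ew Aw]; split => //; rewrite /Z mem_set.
Qed.

Lemma mean_at_max_normalize h : l0_nneg_measurable h ->
  mean_at_max (fun x => (zero_ext h (normalize x))%:E) =
  mean_at_max (fun x => (zero_ext h x)%:E).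
Proof.
move=> mh; have mz := measurable_zero_ext mh.
apply: (eq_integral_full mgood Pgood).
- apply: (mJ (F := fun x => (zero_ext h (normalize x))%:E)); apply/measurable_EFinP.
  exact: (measurableT_comp mz measurable_normalize).
- by apply: (mJ (F := fun x => (zero_ext h x)%:E)); exact/measurable_EFinP.
- by move=> w; rewrite mule_ge0// lee_fin// zero_ext_ge0.
- by move=> w; rewrite mule_ge0// lee_fin// zero_ext_ge0.
- move=> w gw; have [xD|xD] := pselect (max_at_origin (spectral Y w)); last first.
    by rewrite indicE memNset// !mul0e.
  congr (_ * (zero_ext h _)%:E)%E.
  by rewrite /normalize (supnorm_firstmax xD) (good_spectral0 gw) rescale1.
Qed.

Context {dispQ : measure_display} {TQ : measurableType dispQ}
  (PQ : probability TQ R) (Q : {RV PQ >-> config}).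
Hypothesis Q_l0 : forall w, l0 (Q w).
Hypothesis Q_norm : {ae PQ, forall w, supnorm (Q w) = 1}.
Hypothesis Q_sum : (\int[PQ]_w sum_power alpha (Q w) < +oo)%E.

(** The common form to which the three statements are reduced. *)
Definition max_formula : Prop :=
  forall h : config -> R, l0_nneg_measurable h -> shift_invariant h ->
    (\int[PQ]_w (zero_ext h (Q w))%:E =
     (vartheta Y)^-1 * mean_at_max (fun x => (zero_ext h x)%:E))%E.

Lemma representative_max_formula :
  anchored_spectral_representative Y Q <-> max_formula.
Proof.
have anch A dZ (TZ : measurableType dZ) (PZ : probability TZ R)
    (Z : {RV PZ >-> config}) (h : config -> R) : anchoring A -> anchored_process Y A Z ->
    l0_nneg_measurable h -> shift_invariant h ->
    expect_l0 PZ (fun w => rescale (supnorm (Z w)) (Z w)) (fun x => (h x)%:E) =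
    ((vartheta Y)^-1 * mean_at_max (fun x => (zero_ext h x)%:E))%E.
  move=> anA anZ mh hs; rewrite expect_l0_zero_ext.
  rewrite (anchored_mean (F := fun x => (zero_ext h (normalize x))%:E) anA anZ).
  - by rewrite mean_at_max_normalize.
  - apply/measurable_EFinP.
    exact: (measurableT_comp (measurable_zero_ext mh) measurable_normalize).
  - by move=> x; rewrite lee_fin zero_ext_ge0.
  - by move=> x k; rewrite normalize_shift zero_ext_shift.
  - move=> w gw; have [c c0 ->] := spectral_rescale gw.
    by have [k xk] := good_firstmax gw; rewrite (normalize_rescale c0 xk).
split.
- move=> [A [anA [dZ [TZ [PZ [Z [anZ HQ]]]]]]] h mh hs.
  by rewrite -expect_l0_zero_ext HQ// (anch A).
- move=> HQ; exists first_maximizer; split; first exact: anchoring_first_maximizer.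
  have [dZ [TZ [PZ [Z anZ]]]] := exists_anchored_process (@anchoring_first_maximizer R d).
  exists dZ, TZ, PZ, Z; split => // h mh hs.
  rewrite expect_l0_zero_ext HQ// (anch first_maximizer)//.
  exact: anchoring_first_maximizer.
Qed.

Lemma ratio_max_formula :
  (forall h : config -> R, l0_nneg_measurable h -> shift_invariant h ->
      expect_l0 PQ Q (fun x => (h x)%:E) =
      ((vartheta Y)^-1 *
        expect_l0 P (spectral Y) (fun x =>
          (h (rescale (supnorm x) x))%:E *
          ((supnorm x `^ alpha)%:E / sum_power alpha x)))%E) <-> max_formula.
Proof.
have E h : l0_nneg_measurable h -> shift_invariant h ->
    expect_l0 P (spectral Y) (fun x =>
          (h (rescale (supnorm x) x))%:E *
          ((supnorm x `^ alpha)%:E / sum_power alpha x))%E =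
    mean_at_max (fun x => (zero_ext h x)%:E).
  move=> mh hs; rewrite -(mean_spectral_ratio)//.
  by apply: eq_integral => w; rewrite inE => wl; rewrite spectral_ratioE.
by split => H h mh hs; have := H h mh hs; rewrite expect_l0_zero_ext E.
Qed.

(** The shift-invariant function whose mean over Q appears in the time change
    formula, and whose mean over D is E[h(Theta)]. *)
Definition recentered_sum (h : config -> R) (x : config) : \bar R :=
  (\esum_(k in [set: site d]) ((zero_ext h (recenter k x))%:E * (`|x k| `^ alpha)%:E))%E.

Lemma measurable_recentered_sum h : l0_nneg_measurable h ->
  measurable_fun [set: config] (recentered_sum h).
Proof.
move=> mh; apply: measurable_fun_esum => [k|k x]; last first.
  by rewrite mule_ge0// lee_fin ?powR_ge0// zero_ext_ge0.
apply: emeasurable_funM; last exact: measurable_norm_coord_powR.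
apply/measurable_EFinP.
exact: (measurableT_comp (measurable_zero_ext mh) (measurable_recenter k)).
Qed.

Lemma recentered_sum_ge0 h x : l0_nneg_measurable h -> (0 <= recentered_sum h x)%E.
Proof.
by move=> mh; apply: esum_ge0 => k _; rewrite mule_ge0// lee_fin ?powR_ge0// zero_ext_ge0.
Qed.

Lemma recentered_sum_shift h x k : recentered_sum h (site_shift k x) = recentered_sum h x.
Proof.
rewrite /recentered_sum -(esum_shift k (fun i =>
  (zero_ext h (recenter i x))%:E * (`|x i| `^ alpha)%:E)%E).
by apply: eq_esum => i _; rewrite /recenter shift_shift shiftE.
Qed.

Lemma recentered_sumE h x : l0 x ->
  (\esum_(k in [set: site d])
     (if x k == 0%R then 0%E
      else (h (rescale `|x k| (site_shift k x)) * `|x k| `^ alpha)%R%:E) =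
   recentered_sum h x)%E.
Proof.
move=> xl; apply: eq_esum => k _; have [->|xk] := eqVneq (x k) 0.
  by rewrite normr0 powR0 ?gt_eqF// mule0.
rewrite -EFinM recenterE zero_extE//.
by apply: l0_rescale; exact: l0_shift.
Qed.

(** The function [recentered_sum h] may be infinite, hence the extension of the
    formula to values in [0, +oo], by truncation. *)
Lemma max_formula_ereal (F : config -> \bar R) : max_formula ->
  measurable_fun [set: config] F -> (forall x, 0 <= F x)%E ->
  (forall x k, F (site_shift k x) = F x) ->
  (\int[PQ]_w F (Q w) = (vartheta Y)^-1 * mean_at_max F)%E.
Proof.
move=> HQ mF F0 Fs.
have [r r0 vr] := vartheta_real.
(* truncations of F, which are finite and hence covered by the real formula *)
pose Fn n (x : config) : \bar R := mine (F x) n%:R%:E.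
have Fnfin n x : Fn n x \is a fin_num.
  rewrite ge0_fin_numE; last by rewrite le_min F0 lee_fin ler0n.
  by apply: le_lt_trans (ltry n%:R); rewrite ge_min lexx orbT.
have Fn0 n x : (0 <= Fn n x)%E by rewrite le_min F0 lee_fin ler0n.
have mFn n : measurable_fun [set: config] (Fn n) by apply: measurable_mine.
have Fnnd x : nondecreasing_seq (fun n => Fn n x).
  by move=> m n mn; rewrite le_min ge_min lexx ge_min /= !lee_fin ler_nat mn orbT.
pose hn n (x : config) : R := fine (Fn n x).
have mhn n : l0_nneg_measurable (hn n).
  split; last by move=> x _; exact: fine_ge0.
  by apply: measurable_funTS; exact: (measurableT_comp (fine_measurable _) (mFn n)).
have hns n : shift_invariant (hn n) by move=> x _ k; rewrite /hn /Fn Fs.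
have EQ n : (\int[PQ]_w Fn n (Q w) = (vartheta Y)^-1 * mean_at_max (Fn n))%E.
  transitivity (\int[PQ]_w (zero_ext (hn n) (Q w))%:E)%E.
    by apply: eq_integral => w _; rewrite zero_extE// fineK.
  rewrite HQ//; congr (_ * _)%E.
  apply: (eq_integral_full mgood Pgood).
  - apply: (mJ (F := fun x => (zero_ext (hn n) x)%:E)); apply/measurable_EFinP.
    exact: measurable_zero_ext.
  - exact: (mJ (mFn n)).
  - by move=> w; rewrite mule_ge0// lee_fin// zero_ext_ge0.
  - by move=> w; rewrite mule_ge0// lee_fin.
  - by move=> w [Sl _]; rewrite zero_extE// fineK.
have L1 : (\int[PQ]_w Fn n (Q w))%E @[n --> \oo] --> (\int[PQ]_w F (Q w))%E.
  rewrite [X in _ --> X](_ : _ = (\int[PQ]_w limn (fun n => Fn n (Q w)))%E); last first.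
    by apply: eq_integral => w _; rewrite limn_mine.
  apply: cvg_monotone_convergence => //.
  by move=> n; exact: (measurableT_comp (mFn n)).
have L2 : mean_at_max (Fn n) @[n --> \oo] --> mean_at_max F.
  rewrite [X in _ --> X](_ : _ = (\int[P]_w limn (fun n =>
      (\1_max_at_origin (spectral Y w))%:E * Fn n (spectral Y w)))%E); last first.
    apply: eq_integral => w _; rewrite indicE; case: (_ \in _).
      under eq_fun do rewrite mul1e.
      by rewrite mul1e limn_mine.
    under eq_fun do rewrite mul0e.
    by rewrite mul0e lim_cst.
  apply: cvg_monotone_convergence => //.
  - by move=> n; exact: (mJ (mFn n)).
  - by move=> n w _; rewrite mule_ge0// lee_fin.
  - by move=> w _ m n mn; apply: lee_wpmul2l; [rewrite lee_fin|exact: Fnnd].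
have L3 : ((vartheta Y)^-1 * mean_at_max (Fn n))%E @[n --> \oo] -->
    ((vartheta Y)^-1 * mean_at_max F)%E.
  by apply: cvgeZl => //; rewrite vr inver gt_eqF.
by apply: (ereal_lim_near_unique L1 L3); exact: nearW.
Qed.

Definition time_change_formula : Prop :=
  forall h : config -> R, l0_nneg_measurable h ->
    expect_l0 P (spectral Y) (fun x => (h x)%:E) =
    ((\int[PQ]_w sum_power alpha (Q w))^-1 *
      \int[PQ]_w \esum_(k in [set: site d])
        (if Q w k == 0%R then 0%E
         else (h (rescale `|Q w k| (site_shift k (Q w))) * `|Q w k| `^ alpha)%R%:E))%E.

(** Both E[sum_k |Q_k|^alpha] = 1/vartheta and the numerator come from the
    extended formula combined with [spectral_decomposition]. *)
Lemma max_formula_time_change_formula : max_formula -> time_change_formula.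
Proof.
move=> HQ h mh; have [r r0 vr] := vartheta_real.
have S1 : (\int[PQ]_w sum_power alpha (Q w) = (vartheta Y)^-1)%E.
  rewrite (max_formula_ereal HQ)//.
  - by rewrite (mean_at_max_sum_power) mule1.
  - exact: measurable_sum_power.
  - by move=> x; exact: sum_power_ge0.
  - by move=> x k; exact: sum_power_shift.
rewrite S1 inveK.
under [in RHS]eq_integral do rewrite recentered_sumE//.
rewrite (max_formula_ereal HQ); last first.
- exact: recentered_sum_shift.
- by move=> x; exact: recentered_sum_ge0.
- exact: measurable_recentered_sum.
rewrite muleA vr inver gt_eqF// -EFinM divff ?gt_eqF// mul1e.
rewrite expect_l0_zero_ext.
apply: (spectral_decomposition
  (H := fun x => (zero_ext h x)%:E)).
  by apply/measurable_EFinP; exact: measurable_zero_ext.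
by move=> x; rewrite lee_fin zero_ext_ge0.
Qed.

(** Since |Q| = 1, the sum that belongs to [spectral_ratio alpha h] at Q is
    h(Q), so the formula holds up to a constant, and h = 1 shows that the
    constant is vartheta. *)
Lemma time_change_formula_max_formula : time_change_formula -> max_formula.
Proof.
move=> HQ; set s := (\int[PQ]_w sum_power alpha (Q w))%E in HQ.
have [N1 [mN1 PN1 N1E]] := full_of_ae Q_norm.
have mSQ : measurable_fun [set: TQ] (fun w => sum_power alpha (Q w)).
  exact: (measurableT_comp (measurable_sum_power alpha)).
have [N2 [mN2 PN2 N2E]] := full_lty mSQ (fun w => sum_power_ge0 alpha (Q w)) Q_sum.
have key h : l0_nneg_measurable h -> shift_invariant h ->
    mean_at_max (fun x => (zero_ext h x)%:E) = (s^-1 * \int[PQ]_w (zero_ext h (Q w))%:E)%E.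
  move=> mh hs.
  rewrite -(mean_spectral_ratio)//.
  have mg := spectral_ratio_l0_nneg_measurable alpha mh.
  rewrite HQ//; congr (_ * _)%E.
  under eq_integral do rewrite recentered_sumE//.
  apply: (@eq_integral_full _ _ _ PQ (N1 `&` N2)).
  - exact: measurableI.
  - by rewrite probability_setI1.
  - exact: (measurableT_comp (measurable_recentered_sum mg)).
  - apply/measurable_EFinP; exact: (measurableT_comp (measurable_zero_ext mh)).
  - by move=> w; exact: recentered_sum_ge0.
  - by move=> w; rewrite lee_fin zero_ext_ge0.
  - move=> w [/N1E Q1 /N2E QS].
    have [k xk] : exists k, Q w k != 0.
      apply: contrapT => nk; have : supnorm (Q w) = 0.
        apply/eqP; rewrite eq_le supnorm_ge0 andbT; apply: ge_sup.
          by exists `|Q w 0|; exists 0.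
        move=> _ [i _ <-]; rewrite normr_le0; apply/negPn/negP => xi.
        by apply: nk; exists i.
      by rewrite Q1 => /eqP; rewrite oner_eq0.
    have [j xj] := firstmax_exists_neq0 (Q_l0 w) xk.
    have xj0 : Q w j != 0.
      by rewrite -normr_gt0; apply: lt_le_trans (firstmax_ge k xj); rewrite normr_gt0.
    rewrite /recentered_sum (esum_spectral_ratio alpha0 (Q_l0 w) hs mh xj xj0 QS).
    by rewrite zero_extE// /normalize Q1 rescale1 powR1 mulr1.
have [r r0 vr] := vartheta_real.
have sv : (s^-1 = vartheta Y)%E.
  pose one : config -> R := fun=> 1.
  have h1 : l0_nneg_measurable one by split => //; exact: measurable_cst.
  have hs1 : shift_invariant one by [].
  have := key _ h1 hs1.
  have -> : mean_at_max (fun x => (zero_ext one x)%:E) = mean_at_max (fun=> 1%E).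
    apply: (eq_integral_full mgood Pgood).
    - apply: (mJ (F := fun x => (zero_ext one x)%:E)); apply/measurable_EFinP.
      exact: measurable_zero_ext.
    - exact: (mJ (F := fun=> 1%E)).
    - by move=> w; rewrite mule_ge0// lee_fin// zero_ext_ge0.
    - by move=> w; rewrite mule_ge0// lee_fin.
    - by move=> w [Sl _]; rewrite zero_extE.
  rewrite mean_at_max1 -(vartheta_max) => ->.
  rewrite (_ : (\int[PQ]_w _)%E = 1%E) ?mule1//.
  transitivity (\int[PQ]_w (cst 1 w) : \bar R)%E.
    by apply: eq_integral => w _; rewrite zero_extE.
  by rewrite integral_cst// mul1e; exact: probability_setT.
move=> h mh hs; rewrite key// sv muleA vr inver gt_eqF// -EFinM mulVf ?gt_eqF//.
by rewrite mul1e.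
Qed.

End spectral_tail_process.

(** * The equivalences *)

Theorem proposition3p10
  (R : realType) (d : nat) (hd : (0 < d)%N)
  (dispY : measure_display) (TY : measurableType dispY) (P : probability TY R)
  (Y : {RV P >-> config R d}) (alpha : R)
  (halpha : 0 < alpha)
  (hY : tail_process Y) (hindex : tail_index Y alpha)
  (hTheta : P (spectral Y @^-1` @l0 R d) = 1%E)
  (dispQ : measure_display) (TQ : measurableType dispQ) (PQ : probability TQ R)
  (Q : {RV PQ >-> config R d})
  (hQl0 : forall w, l0 (Q w))
  (hQnorm : {ae PQ, forall w, supnorm (Q w) = 1})
  (hQsum : (\int[PQ]_w sum_power alpha (Q w) < +oo)%E) :
  let stmt_i := anchored_spectral_representative Y Q in
  let stmt_ii :=
    forall h : config R d -> R, l0_nneg_measurable h ->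
      expect_l0 P (spectral Y) (fun x => (h x)%:E) =
      ((\int[PQ]_w sum_power alpha (Q w))^-1 *
        \int[PQ]_w \esum_(k in [set: site d])
          (if Q w k == 0%R then 0%E
           else (h (rescale `|Q w k| (site_shift k (Q w))) * `|Q w k| `^ alpha)%R%:E))%E in
  let stmt_iii :=
    forall h : config R d -> R, l0_nneg_measurable h -> shift_invariant h ->
      expect_l0 PQ Q (fun x => (h x)%:E) =
      ((vartheta Y)^-1 *
        expect_l0 P (spectral Y) (fun x =>
          (h (rescale (supnorm x) x))%:E *
          ((supnorm x `^ alpha)%:E / sum_power alpha x)))%E in
  (stmt_i <-> stmt_ii) /\ (stmt_ii <-> stmt_iii).
Proof.
have [dispX [TX [PX [X [stX tailXY]]]]] := hY.
have radius_gt1 : P (Y @^-1` origin_above 1) = 1%E by have [h _ _] := tailXY.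
have radius_indep := spectral_radius_independent tailXY hindex.
have shift := exceedance_shift_law stX tailXY.
have eq_i := representative_max_formula halpha radius_gt1 hindex radius_indep shift hTheta Q.
have eq_iii := ratio_max_formula halpha radius_gt1 hindex radius_indep shift hTheta Q.
have eq_ii : time_change_formula Y alpha Q <-> max_formula Y Q.
  split.
    exact: (time_change_formula_max_formula halpha radius_gt1 hindex radius_indep
      shift hTheta hQl0 hQnorm hQsum).
  exact: (max_formula_time_change_formula halpha radius_gt1 hindex radius_indep
    shift hTheta hQl0).
move=> stmt_i stmt_ii stmt_iii; split.
  exact: (iff_trans eq_i (iff_sym eq_ii)).
exact: (iff_trans eq_ii (iff_sym eq_iii)).
Qed.
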